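(* There exist numerical constants $c,c',c''>0$ such that the following holds for all $(n\vee p)\ge c'$ and all $\gamma>1$. In the biclustering model described in the context, assume that the hidden partitions $G^*$ and $H^*$ are both $\gamma$-balanced. Then, as long as $$\Delta_r^2\ge c\,\gamma^{5/2}\left[\sqrt{\frac{KL\log(n\vee p)}{n}}+\log(n\vee p)\right]\quad\text{and}\quad \Delta_c^2\ge c\,\gamma^{5/2}\left[\sqrt{\frac{KL\log(n\vee p)}{p}}+\log(n\vee p)\right],$$ the bi-Kmeans estimator $(\hat G,\hat H)$ satisfies $\hat G=G^*$ and $\hat H=H^*$ with probability higher than $1-c''/(n\vee p)^2$.
   Context: Biclustering model: there are unknown partitions $G^*=\{G_1^*,\dots,G_K^*\}$ of $[n]$ and $H^*=\{H_1^*,\dots,H_L^*\}$ of $[p]$ ($K,L\ge2$), an unknown matrix $\mu\in\mathbb R^{K\times L}$ and an unknown $\sigma>0$ such that the entries $Y_{ij}$ of the observed $n\times p$ matrix $Y$ are independent, with $Y_{ij}\sim\mathcal N(\mu_{kl},\sigma^2)$ for $(i,j)\in G_k^*\times H_l^*$. A partition is $\gamma$-balanced if the ratio of its largest to smallest group size is at most $\gamma$. With $\mu_{k:}$ the rows and $\mu_{:l}$ the columns of $\mu$, $$\Delta_r^2=\frac pL\min_{k\ne k'\in[K]}\frac{\|\mu_{k:}-\mu_{k':}\|^2}{2\sigma^2},\qquad \Delta_c^2=\frac nK\min_{l\ne l'\in[L]}\frac{\|\mu_{:l}-\mu_{:l'}\|^2}{2\sigma^2}.$$ The bi-Kmeans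 estimator is any minimizer $$(\hat G,\hat H)\in\mathop{\mathrm{argmin}}_{G,H}\ \sum_{k\in[K],\,l\in[L]}\ \sum_{i\in G_k,\,j\in H_l}\big(Y_{ij}-\bar Y^{G\times H}_{kl}\big)^2$$ over partitions $G$ of $[n]$ into $K$ groups and $H$ of $[p]$ into $L$ groups, where $\bar Y^{G\times H}_{kl}$ is the average of $Y_{ij}$ over $G_k\times H_l$. Equality of partitions is as unlabelled partitions; $a\vee b=\max(a,b)$. *)

(* Defs.v *)
From HB Require Import structures.
From mathcomp Require Import all_boot all_order all_algebra.
From mathcomp Require Import all_classical all_reals all_analysis.

Set Implicit Arguments.
Unset Strict Implicit.
Unset Printing Implicit Defensive.

Import Order.TTheory GRing.Theory Num.Theory.
Import numFieldNormedType.Exports.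

Local Open Scope classical_set_scope.
Local Open Scope ring_scope.

(* Unlabelled partitions are sets of blocks; the blocks of a [finset.partition] are
   nonempty. *)
Definition partition_into (T : finType) (K : nat) (G : {set {set T}}) : bool :=
  finset.partition G [set: T]%SET && (#|G| == K).

Definition unlabel (T : finType) (K : nat) (G : 'I_K -> {set T}) :
    {set {set T}} :=
  (G @: [set: 'I_K])%SET.

(* The neutral element #|T| of the minimum is harmless: no block is larger. *)
Definition balanced (R : realType) (T : finType) (gamma : R)
    (G : {set {set T}}) : Prop :=
  (\max_(A in G) #|A|)%N%:R / (\big[minn/#|T|]_(A in G) #|A|)%:R <= gamma.

Definition block_mean (R : realType) (n p : nat) (Y : 'M[R]_(n, p))
    (A : {set 'I_n}) (B : {set 'I_p}) : R :=
  (\sum_(i in A) \sum_(j in B) Y i j) / (#|A| * #|B|)%:R.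

Definition biKmeans_crit (R : realType) (n p : nat) (Y : 'M[R]_(n, p))
    (G : {set {set 'I_n}}) (H : {set {set 'I_p}}) : R :=
  \sum_(A in G) \sum_(B in H) \sum_(i in A) \sum_(j in B)
    (Y i j - block_mean Y A B) ^+ 2.

Definition is_biKmeans (R : realType) (n p K L : nat) (Y : 'M[R]_(n, p))
    (G : {set {set 'I_n}}) (H : {set {set 'I_p}}) : Prop :=
  [/\ partition_into K G, partition_into L H &
      forall (G' : {set {set 'I_n}}) (H' : {set {set 'I_p}}),
        partition_into K G' -> partition_into L H' ->
        biKmeans_crit Y G H <= biKmeans_crit Y G' H'].

(* The norm [`|_|] on matrices is the sup norm, so the squared Euclidean norm
   is written out. *)
Definition sqnorm2 (R : realType) (m n : nat) (v : 'M[R]_(m, n)) : R :=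
  \sum_i \sum_j v i j ^+ 2.

(* For at least two groups, these are infima of finite nonempty sets, i.e.
   minima. *)
Definition Delta_r2 (R : realType) (p K L : nat) (mu : 'M[R]_(K, L))
    (sigma : R) : R :=
  p%:R / L%:R *
  inf [set sqnorm2 (row k.1 mu - row k.2 mu) / (2 * sigma ^+ 2)
      | k in [set k : 'I_K * 'I_K | k.1 != k.2]].

Definition Delta_c2 (R : realType) (n K L : nat) (mu : 'M[R]_(K, L))
    (sigma : R) : R :=
  n%:R / K%:R *
  inf [set sqnorm2 (col l.1 mu - col l.2 mu) / (2 * sigma ^+ 2)
      | l in [set l : 'I_L * 'I_L | l.1 != l.2]].

Definition mutually_independent (R : realType) (d : measure_display)
    (T : measurableType d) (P : probability T R) (I : finType)
    (X : I -> {RV P >-> R}) : Prop :=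
  forall (J : {set I}) (B : I -> set R),
    (forall i, measurable (B i)) ->
    P (\bigcap_(i in [set` J]) (X i @^-1` B i)) =
    (\prod_(i in J) P (X i @^-1` B i))%E.

(* The two laws are compared on measurable sets only: [normal_prob] and
   [distribution] are functions defined on all sets, with meaningless values
   off the sigma-algebra. *)
Definition has_normal_law (R : realType) (d : measure_display)
    (T : measurableType d) (P : probability T R) (X : {RV P >-> R})
    (m s : R) : Prop :=
  forall B : set R, measurable B -> distribution P X B = normal_prob m s B.

(* [Gs] and [Hs] list the groups of the hidden partitions; the cardinality
   conditions in [partition_into] make the labels distinct. *)
Definition biclustering_model (R : realType) (d : measure_display)
    (T : measurableType d) (P : probability T R) (n p K L : nat)
    (Y : 'I_n * 'I_p -> {RV P >-> R})
    (Gs : 'I_K -> {set 'I_n}) (Hs : 'I_L -> {set 'I_p})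
    (mu : 'M[R]_(K, L)) (sigma : R) : Prop :=
  [/\ partition_into K (unlabel Gs), partition_into L (unlabel Hs),
      0 < sigma, mutually_independent Y &
      forall (k : 'I_K) (l : 'I_L) (i : 'I_n) (j : 'I_p),
        i \in Gs k -> j \in Hs l ->
        has_normal_law (Y (i, j)) (mu k l) sigma].

Definition observed (R : realType) (d : measure_display)
    (T : measurableType d) (P : probability T R) (n p : nat)
    (Y : 'I_n * 'I_p -> {RV P >-> R}) (w : T) : 'M[R]_(n, p) :=
  \matrix_(i, j) Y (i, j) w.

(* The event that every minimiser of the criterion is the hidden pair; it
   controls any choice of the estimator among the minimisers. *)
Definition exact_recovery (R : realType) (d : measure_display)
    (T : measurableType d) (P : probability T R) (n p K L : nat)
    (Y : 'I_n * 'I_p -> {RV P >-> R})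
    (Gs : 'I_K -> {set 'I_n}) (Hs : 'I_L -> {set 'I_p}) : set T :=
  [set w | forall (G : {set {set 'I_n}}) (H : {set {set 'I_p}}),
     is_biKmeans K L (observed Y w) G H ->
     G = unlabel Gs /\ H = unlabel Hs].

(* Main.v *)
Require Import Defs.
From HB Require Import structures.
From mathcomp Require Import all_boot all_order all_algebra.
From mathcomp Require Import all_classical all_reals all_analysis.
From mathcomp Require Import fingroup perm.
From mathcomp Require Import measurable_realfun ring lra.
Set Implicit Arguments.
Unset Strict Implicit.
Unset Printing Implicit Defensive.
Import Order.TTheory GRing.Theory Num.Theory.
Import numFieldNormedType.Exports.
Local Open Scope classical_set_scope.
Local Open Scope ring_scope.

(* Minimising the criterion amounts to maximising |P_G Y P_H|^2, where P_G and P_H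
   average over the groups. Write Y = M + sigma x and let S be the squared distance
   from M to P_G M P_H. The criterion at (G, H) exceeds the one at the truth by S
   plus a linear term, which AM-GM absorbs into S/2 and a rank-one quadratic form
   of x, minus the form of P_G (x) P_H - P_0 (x) Q_0, which is split as
   (P_G - P_0) (x) Q_0 + P_0 (x) (P_H - Q_0) + (P_G - P_0) (x) (P_H - Q_0).
   The first two forms depend on one partition only, so each is union bounded
   over that partition alone; bounding the difference in one piece would lose
   when n and p are very different.

   If m rows and q columns are misclassified (after relabelling), the three forms
   are centred, with squared Frobenius norms controlled through
   |P_G - P_0|^2 <= 12 m gamma K / n, and a pair of labellings gets weight
   (n v p)^(-4(m+q)); these weights sum to O((n v p)^-2) over the wrong labellings.
   The signal satisfies S >= sigma^2 Delta_r^2 m / (2 gamma^2), and likewise for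
   the columns, because a group mixing several true groups has a large variance
   and a majority vote can be turned into a permutation at the cost of a factor
   1 + gamma.

   The tail of the Gaussian quadratic forms needs no spectral theorem: the
   coordinates are integrated out one at a time, and each integration replaces
   the matrix by a Schur complement. *)

(** * Gaussian integrals and independence *)

(** The Radon-Nikodym derivative of the normal law agrees almost everywhere with the normal density,
    since both integrate to that law over every measurable set; the change of variables does the
    rest. *)
Lemma ge0_integral_normal_prob (R : realType) (m s : R) (f : R -> \bar R) :
  (forall x, 0 <= f x)%E -> measurable_fun [set: R] f ->
  (\int[normal_prob m s]_x f x =
   \int[lebesgue_measure]_x (f x * (normal_pdf m s x)%:E))%E.
Proof.
move=> f0 mf; have dom := @normal_prob_dominates R m s.
rewrite -(Radon_Nikodym_SigmaFinite.change_of_variables dom)//.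
have mD : measurable_fun [set: R]
    (Radon_Nikodym_SigmaFinite.f (normal_prob m s) (@lebesgue_measure R)).
  exact: measurable_int (Radon_Nikodym_SigmaFinite.f_integrable dom).
have mp : measurable_fun [set: R] (fun x : R => (normal_pdf m s x)%:E).
  by apply/measurable_EFinP; exact: measurable_normal_pdf.
apply: ae_eq_integral => //; [exact: emeasurable_funM|exact: emeasurable_funM|].
apply: ae_eqe_mul2l; apply: integral_ae_eq => //.
  exact: Radon_Nikodym_SigmaFinite.f_integrable.
by move=> A _ mA; rewrite -Radon_Nikodym_SigmaFinite.f_integral.
Qed.

Lemma measurable_expR_quad (R : realType) (m s a b : R) :
  measurable_fun [set: R]
    (fun x : R => expR (a / 2 * ((x - m) / s) ^+ 2 + b * ((x - m) / s))).
Proof.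
have mx : measurable_fun [set: R] (fun x : R => (x - m) / s).
  by apply: measurable_funM => //; exact: measurable_funB.
apply: measurableT_comp => //; apply: measurable_funD.
  by apply: measurable_funM => //; exact: measurable_funX.
exact: measurable_funM.
Qed.

(** Completing the square: the integrand times the density is a constant multiple of the normal
    density of mean [m'] and standard deviation [s'], which integrates to 1. *)
Lemma integral_normal_prob_expR_quad (R : realType) (m s a b : R) :
  0 < s -> a < 1 ->
  (\int[normal_prob m s]_x
     (expR (a / 2 * ((x - m) / s) ^+ 2 + b * ((x - m) / s)))%:E)%E =
  ((Num.sqrt (1 - a))^-1 * expR (b ^+ 2 / (2 * (1 - a))))%:E.
Proof.
move=> s0 a1.
have a0 : 0 < 1 - a by rewrite subr_gt0.
rewrite ge0_integral_normal_prob; last 2 first.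
- by move=> x; rewrite lee_fin expR_ge0.
- by apply/measurable_EFinP; exact: measurable_expR_quad.
set r := Num.sqrt (1 - a).
have r0 : 0 < r by rewrite sqrtr_gt0.
have r2 : r ^+ 2 = 1 - a by rewrite sqr_sqrtr ?ltW.
pose m' := m + s * b / (1 - a); pose s' := s / r.
have s'0 : 0 < s' by rewrite divr_gt0.
transitivity (\int[lebesgue_measure]_x
    ((r^-1 * expR (b ^+ 2 / (2 * (1 - a))))%:E * (normal_pdf m' s' x)%:E))%E.
  apply: eq_integral => x _; rewrite -!EFinM; congr EFin.
  rewrite !normal_pdfE ?gt_eqF//= /normal_fun.
  have -> : normal_peak s' = r * normal_peak s.
    rewrite /normal_peak /s' expr_div_n -mulrnAr mulrAC sqrtrM.
      by rewrite -exprVn sqrtr_sqr ger0_norm ?invr_ge0 ?ltW// invfM invrK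
        mulrC mulrnAr.
    by rewrite mulr_ge0 ?sqr_ge0// mulrn_wge0 ?pi_ge0.
  rewrite [RHS]mulrACA mulKf ?gt_eqF// [LHS]mulrCA -!expRD; congr (_ * expR _).
  have {1}-> : a = 1 - r ^+ 2 by rewrite r2; ring.
  by rewrite /m' /s' -r2; field; rewrite !gt_eqF.
rewrite ge0_integralZl//.
- by rewrite integral_normal_pdf mule1.
- by apply/measurable_EFinP; exact: measurable_normal_pdf.
- by move=> x _; rewrite lee_fin normal_pdf_ge0.
by rewrite lee_fin mulr_ge0 ?expR_ge0// invr_ge0 ltW.
Qed.

Section independence.
Context {R : realType} {d : measure_display} {T : measurableType d}.
Context {P : probability T R} {I : finType} {Y : I -> {RV P >-> R}}.
Hypothesis indY : mutually_independent Y.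

(** A pi-system generating the sigma-algebra of all coordinates except [i]. *)
Definition other_cylinders (i : I) : set (set T) :=
  [set A | exists2 B : I -> set R, (forall j, measurable (B j)) &
     A = \bigcap_(j in [set` [set~ i]%SET]) (Y j @^-1` B j)].

Lemma other_cylinders_measurable i : other_cylinders i `<=` measurable.
Proof.
move=> _ [B mB ->]; apply: fin_bigcap_measurable => // j _.
by rewrite -[X in measurable X]setTI; apply: measurable_funP.
Qed.

Lemma other_cylinders_setI i : setI_closed (other_cylinders i).
Proof.
move=> _ _ [A mA ->] [B mB ->]; exists (fun j => A j `&` B j).
  by move=> j; exact: measurableI.
by rewrite -bigcapI.
Qed.

(** Both sides are finite measures in [A], so it is enough to compare them on the pi-system of
    cylinders, where mutual independence applies. *)
Lemma coord_indep_others (i : I) (C : set R) (A : set T) :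
  measurable C -> <<s other_cylinders i >> A ->
  P (A `&` Y i @^-1` C) = (P (Y i @^-1` C) * P A)%E.
Proof.
move=> mC sA.
have mYC : measurable (Y i @^-1` C).
  by rewrite -[X in measurable X]setTI; apply: measurable_funP.
have fP : P (Y i @^-1` C) \is a fin_num by exact: fin_num_measure.
have k0 : 0 <= fine (P (Y i @^-1` C)) by exact: fine_ge0.
have m1E X : mrestr P mYC X = P (X `&` Y i @^-1` C) by [].
have m2E X : mscale (NngNum k0) P X = (P (Y i @^-1` C) * P X)%E.
  by rewrite -[X in (X * _)%E]fineK.
rewrite -m1E -m2E.
apply: (g_sigma_algebra_measure_unique (other_cylinders i) _ (fun=> setT)) => //.
  - exact: other_cylinders_measurable.
  - move=> _; exists (fun=> setT) => //.
    by apply/seteqP; split => // x _ j.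
  - by rewrite bigcup_const//; exists 0%N.
  - exact: other_cylinders_setI.
  - move=> _ [B mB ->]; apply: etrans (m1E _) _; apply: etrans _ (esym (m2E _)).
    (* Independence is used twice: over all indices with [C] in position [i], and over the indices
       other than [i]. *)
    set B' := fun j => if j == i then C else B j.
    have mB' j : measurable (B' j) by rewrite /B'; case: ifP.
    rewrite (indY [set~ i]%SET mB).
    have := indY [set: I]%SET mB'; rewrite (bigD1 i) ?inE//=.
    have -> : \bigcap_(j in [set` [set: I]%SET]) (Y j @^-1` B' j) =
        \bigcap_(j in [set` [set~ i]%SET]) (Y j @^-1` B j) `&` Y i @^-1` C.
      apply/seteqP; split => [x H|x [H HC] j _].
        split; last by have := H i; rewrite /B' /= eqxx; apply; rewrite inE.
        move=> j; rewrite /= inE => /set1P/eqP ji.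
        by have := H j; rewrite /= /B' (negPf ji); apply; rewrite inE.
      rewrite /= /B'; case: eqVneq => [->//|ji].
      by apply: H; rewrite /= !inE.
    move=> ->; rewrite {1}/B' eqxx; congr (_ * _)%E.
    apply: eq_big => [j|j ji]; first by rewrite !inE.
    by rewrite /B'; move: ji; rewrite !inE => /negPf ->.
  - move=> _; apply: (@le_lt_trans _ _ 1%E); last exact: ltry.
    by apply: probability_le1; exact: measurableI.
Qed.

(** The joint law of [Y i] and [V] is a product measure, and Tonelli's theorem applies. [V] has two
    components to carry the two statistics of the other coordinates on which a quadratic form
    depends once [Y i] is singled out. *)
Lemma coord_indep_fubini (i : I) (V : T -> R * R) (f : R * (R * R) -> \bar R) :
  (forall S, measurable S -> <<s other_cylinders i >> (V @^-1` S)) ->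
  measurable_fun setT f -> (forall x, 0 <= f x)%E ->
  (\int[P]_w f (Y i w, V w) =
   \int[P]_w \int[distribution P (Y i)]_y f (y, V w))%E.
Proof.
move=> sV mf f0.
have mV : measurable_fun setT V.
  move=> _ S mS; rewrite setTI.
  have := sV S mS; apply: smallest_sub => //; first exact: sigma_algebra_measurable.
  exact: other_cylinders_measurable.
pose V' : {mfun T >-> (R * R)%type} := HB.pack V (isMeasurableFun.Build _ _ _ _ V mV).
have mYV : measurable_fun setT (fun w => (Y i w, V w)) by exact/measurable_fun_pair.
pose YV : {mfun T >-> (R * (R * R))%type} :=
  HB.pack (fun w => (Y i w, V w)) (isMeasurableFun.Build _ _ _ _ _ mYV).
transitivity (\int[distribution P YV]_z f z)%E.
  by rewrite ge0_integral_distribution.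
transitivity (\int[distribution P (Y i) \x distribution P V']_z f z)%E.
  apply: eq_measure_integral => S mS _; symmetry.
  apply: product_measure_unique => // A B mA mB.
  rewrite /distribution /pushforward/=.
  rewrite -coord_indep_others//; last exact: sV.
  by congr (P _); apply/seteqP; split => [x []|x []].
rewrite fubini_tonelli2// ge0_integral_distribution//.
  exact: measurable_fun_fubini_tonelli_G.
by move=> y; apply: integral_ge0.
Qed.
End independence.

(** * Quadratic forms of Gaussian vectors *)

Section quadratic_forms.
Context {R : realType} {I : finType}.
Implicit Types (J : {set I}) (A : I -> I -> R) (y : I -> R).

(** The sums run over a subset [J] so that coordinates can be removed one at a time over a fixed
    index type. *)
Definition qform J A y := \sum_(i in J) \sum_(j in J) A i j * y i * y j.

Lemma qform_setD1 J A y i : i \in J -> (forall i j, A i j = A j i) ->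
  qform J A y = A i i * y i ^+ 2 +
    2 * y i * (\sum_(j in J :\ i) A i j * y j) + qform (J :\ i) A y.
Proof.
move=> iJ sA; rewrite /qform (big_setD1 i iJ)/= (big_setD1 i iJ)/=.
under [X in _ + X = _]eq_bigr => k _ do rewrite (big_setD1 i iJ)/=.
rewrite big_split/= addrA; congr (_ + _).
set b := \sum_(j in J :\ i) A i j * y j.
have -> : \sum_(j in J :\ i) A i j * y i * y j = y i * b.
  by rewrite mulr_sumr; apply: eq_bigr => j _; ring.
have -> : \sum_(j in J :\ i) A j i * y j * y i = y i * b.
  by rewrite mulr_sumr; apply: eq_bigr => j _; rewrite (sA j i); ring.
by ring.
Qed.

Lemma sqr_sumE J y : (\sum_(j in J) y j) ^+ 2 =
  \sum_(i in J) \sum_(j in J) y i * y j.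
Proof. by rewrite expr2 mulr_suml; apply: eq_bigr => i _; rewrite mulr_sumr. Qed.

(** Off [i], the identity minus [schur A i] is the Schur complement of the entry [(i, i)] in the
    identity minus [A]. *)
Definition schur A i j k := A j k + A i j * A i k / (1 - A i i).

Lemma qform_schur J A i y : qform J (schur A i) y =
  qform J A y + (\sum_(j in J) A i j * y j) ^+ 2 / (1 - A i i).
Proof.
rewrite sqr_sumE /qform mulr_suml -big_split; apply: eq_bigr => j _ /=.
rewrite mulr_suml -big_split; apply: eq_bigr => k _ /=.
by rewrite /schur; ring.
Qed.

Lemma schur_bound J A i (t : R) : i \in J -> (forall i j, A i j = A j i) ->
  t < 1 ->
  (forall y, qform J A y <= t * \sum_(j in J) y j ^+ 2) ->
  A i i <= t /\
  (forall y, qform (J :\ i) (schur A i) y <= t * \sum_(j in J :\ i) y j ^+ 2).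
Proof.
move=> iJ sA t1 H.
have D y x : A i i * x ^+ 2 + 2 * x * (\sum_(j in J :\ i) A i j * y j) +
    qform (J :\ i) A y <= t * (x ^+ 2 + \sum_(j in J :\ i) y j ^+ 2).
  pose y' j := if j == i then x else y j.
  have E j : j \in J :\ i -> y' j = y j.
    by rewrite /y' in_setD1 => /andP[/negPf ->].
  have yi : y' i = x by rewrite /y' eqxx.
  have := H y'; rewrite (qform_setD1 _ iJ sA) (big_setD1 i iJ)/= yi.
  have -> : \sum_(j in J :\ i) A i j * y' j = \sum_(j in J :\ i) A i j * y j.
    by apply: eq_bigr => j /E ->.
  have -> : \sum_(j in J :\ i) y' j ^+ 2 = \sum_(j in J :\ i) y j ^+ 2.
    by apply: eq_bigr => j /E ->.
  rewrite (_ : qform (J :\ i) A y' = qform (J :\ i) A y)//.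
  by rewrite /qform; apply: eq_bigr => j jJ; apply: eq_bigr => k kJ; rewrite !E.
have a1 : A i i <= t.
  have := D (fun=> 0) 1; rewrite /qform.
  rewrite big1; last by move=> j _; rewrite mulr0.
  rewrite big1; last by move=> j _; rewrite big1// => k _; rewrite mulr0.
  rewrite big1; last by move=> j _; rewrite expr0n.
  by rewrite expr1n !addr0 mulr0 addr0 !mulr1.
split => // y; rewrite qform_schur.
set b := \sum_(j in _) _; set S := \sum_(j in _) _.
have a0 : 0 < 1 - A i i by lra.
(* This value of [x] maximises [A i i * x ^+ 2 + 2 * x * b - x ^+ 2], and the maximum is the Schur
   correction. Passing from [x ^+ 2] to [t * x ^+ 2] leaves a nonnegative slack. *)
have := D y (b / (1 - A i i)); rewrite -/b -/S.
set q := qform _ _ _ => {}H.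
have E : b ^+ 2 / (1 - A i i) + (1 - t) * (b / (1 - A i i)) ^+ 2 =
    A i i * (b / (1 - A i i)) ^+ 2 + 2 * (b / (1 - A i i)) * b -
    t * (b / (1 - A i i)) ^+ 2.
  by field; rewrite gt_eqF.
have : 0 <= (1 - t) * (b / (1 - A i i)) ^+ 2.
  by rewrite mulr_ge0 ?sqr_ge0//; lra.
lra.
Qed.

Lemma schur_sym A i : (forall i j, A i j = A j i) ->
  forall j k, schur A i j k = schur A i k j.
Proof. by move=> sA j k; rewrite /schur (sA j k) [A i j * _]mulrC. Qed.

(** After squaring, for [a <= 0] the tangent bound on [expR] suffices because
    [(1 + a + a ^+ 2) * (1 - a) = 1 - a ^+ 3]. For [a > 0] that falls short, and the tangent bound
    is taken at half the exponent and then squared. *)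
Lemma inv_sqrt_le_expR (a : R) : a <= 1 / 4 ->
  (Num.sqrt (1 - a))^-1 <= expR ((a + a ^+ 2) / 2).
Proof.
move=> a1; have a0 : 0 < 1 - a by lra.
have s0 : 0 < Num.sqrt (1 - a) by rewrite sqrtr_gt0.
rewrite -ler_sqr ?nnegrE ?invr_ge0 ?expR_ge0 ?(ltW s0)//.
rewrite exprVn sqr_sqrtr ?(ltW a0)//.
rewrite -div1r ler_pdivrMr//.
have e0 := expR_ge1Dx ((a + a ^+ 2) / 2).
have [an|ap] := lerP a 0.
  rewrite -expRM_natr divfK ?pnatr_eq0//.
  by have := expR_ge1Dx (a + a ^+ 2); nra.
have : (1 + (a + a ^+ 2) / 2) ^+ 2 <= expR ((a + a ^+ 2) / 2) ^+ 2.
  by rewrite ler_sqr ?nnegrE ?expR_ge0//; nra.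
suff : 1 <= (1 + (a + a ^+ 2) / 2) ^+ 2 * (1 - a) by nra.
have : 0 <= a ^+ 2 * (1 / 4 - a) by nra.
have : 0 <= a ^+ 3 * (1 - a - a ^+ 2) by rewrite mulr_ge0 ?exprn_ge0 ?ltW//; nra.
nra.
Qed.

(* The left side is what remains after integrating out the coordinate [i]. *)
Lemma schur_mgf_bound J A i : i \in J -> (forall i j, A i j = A j i) ->
  (forall y, qform J A y <= 1 / 4 * \sum_(j in J) y j ^+ 2) ->
  (Num.sqrt (1 - A i i))^-1 *
  expR ((\sum_(j in J :\ i) schur A i j j) / 2 +
        (\sum_(j in J :\ i) \sum_(k in J :\ i) schur A i j k ^+ 2) / 2) <=
  expR ((\sum_(j in J) A j j) / 2 + (\sum_(j in J) \sum_(k in J) A j k ^+ 2) / 2).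
Proof.
move=> iJ sA H; have t1 : 1 / 4 < 1 :> R by lra.
have [a1 H'] := schur_bound iJ sA t1 H.
apply: le_trans (ler_wpM2r (expR_ge0 _) (inv_sqrt_le_expR a1)) _.
rewrite -expRD ler_expR.
set a := A i i in a1 *; set J' := J :\ i.
have a0 : 0 < 1 - a by lra.
pose V := \sum_(j in J') A i j ^+ 2; pose Q := qform J' A (A i).
have V0 : 0 <= V by apply: sumr_ge0 => j _; exact: sqr_ge0.
have -> : \sum_(j in J') schur A i j j = \sum_(j in J') A j j + V / (1 - a).
  by rewrite mulr_suml -big_split; apply: eq_bigr.
have -> : \sum_(j in J') \sum_(k in J') schur A i j k ^+ 2 =
    \sum_(j in J') \sum_(k in J') A j k ^+ 2 + 2 * Q / (1 - a) +
    (V / (1 - a)) ^+ 2.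
  rewrite /Q /qform expr_div_n /V sqr_sumE mulr_sumr !mulr_suml -!big_split.
  apply: eq_bigr => j _ /=; rewrite mulr_sumr !mulr_suml -!big_split.
  by apply: eq_bigr => k _ /=; rewrite /schur -/a; field; rewrite gt_eqF.
rewrite (big_setD1 i iJ)/= -/J' -/a.
have -> : \sum_(j in J) \sum_(k in J) A j k ^+ 2 =
    a ^+ 2 + 2 * V + \sum_(j in J') \sum_(k in J') A j k ^+ 2.
  rewrite (big_setD1 i iJ)/= (big_setD1 i iJ)/=.
  under [X in _ + X = _]eq_bigr => k _ do rewrite (big_setD1 i iJ)/=.
  rewrite big_split/= -/J' -/a.
  rewrite (_ : \sum_(j in J') A j i ^+ 2 = V); last first.
    by apply: eq_bigr => j _; rewrite (sA j i).
  by rewrite -/V; ring.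
(* Testing the Schur form on the row [A i] itself controls the cross term: with [W = V / (1 - a)] it
   gives [Q / (1 - a) <= W / 4 - W ^+ 2]. The goal reduces to
   [W + 2 * Q / (1 - a) + W ^+ 2 <= 2 * V], which then follows from
   [2 * W * (1 / 4 - a) + W ^+ 2 >= 0]. *)
have := H' (A i); rewrite qform_schur -/a -/J'.
rewrite (eq_bigr (fun j => A i j ^+ 2)); last by move=> j _; rewrite expr2.
rewrite -/V -/Q => HQ.
pose W := V / (1 - a).
have W0 : 0 <= W by rewrite divr_ge0 ?(ltW a0).
have VE : V = W * (1 - a) by rewrite /W divfK ?gt_eqF.
have QE : Q / (1 - a) <= W / 4 - W ^+ 2.
  rewrite ler_pdivrMr// -subr_ge0.
  have -> : (W / 4 - W ^+ 2) * (1 - a) - Q = 1 / 4 * V - (Q + V ^+ 2 / (1 - a)).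
    by rewrite VE; field; rewrite gt_eqF.
  by rewrite subr_ge0.
have Wa : 0 <= W * (1 / 4 - a) by rewrite mulr_ge0// subr_ge0.
have W2 : 0 <= W ^+ 2 by rewrite sqr_ge0.
rewrite -/W -mulrA {1}VE; lra.
Qed.

End quadratic_forms.

(* The sigma-algebra of [R] and that of [measurableTypeR R] are convertible, but
   they carry different displays, so the two integrals live over different
   measurable types. *)
Lemma ge0_integral_normal_law (R : realType) d (T : measurableType d)
    (P : probability T R) (X : {RV P >-> R}) (m s : R) (f : R -> \bar R) :
  has_normal_law X m s -> measurable_fun [set: R] f -> (forall x, 0 <= f x)%E ->
  (\int[distribution P X]_x f x = \int[normal_prob m s]_x f x)%E.
Proof.
move=> lawX mf f0; rewrite ge0_integral_distribution//.
have mX : @measurable_fun _ _ T (measurableTypeR R) setT X.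
  by move=> _ B mB; exact: (measurable_funP X).
pose X' : {mfun T >-> measurableTypeR R} :=
  HB.pack (X : T -> measurableTypeR R) (isMeasurableFun.Build _ _ _ _ _ mX).
transitivity (\int[distribution P X']_x f x)%E.
  by rewrite ge0_integral_distribution.
by apply: eq_measure_integral => B mB _; exact: lawX.
Qed.

Lemma measurable_sum_in {R : realType} {I : finType} d (T : measurableType d)
    (J : {set I}) (h : I -> T -> R) :
  (forall j, j \in J -> measurable_fun setT (h j)) ->
  measurable_fun setT (fun w => \sum_(j in J) h j w).
Proof.
move=> mh; rewrite (_ : (fun w => _) =
    fun w => \sum_j (if j \in J then h j w else 0)); last first.
  by apply/funext => w; rewrite big_mkcond.
apply: measurable_sum => j; case: (boolP (j \in J)) => [jJ|_] //.
exact: mh.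
Qed.

Lemma measurable_qform {R : realType} {I : finType} d (T : measurableType d)
    (J : {set I}) (A : I -> I -> R) (X : I -> T -> R) :
  (forall j, j \in J -> measurable_fun setT (X j)) ->
  measurable_fun setT (fun w => qform J A (X ^~ w)).
Proof.
move=> mX; apply: measurable_sum_in => i iJ; apply: measurable_sum_in => j jJ.
apply: measurable_funM; last exact: mX.
by apply: measurable_funM => //; exact: mX.
Qed.

Definition quad {R : realType} {I : finType} (A : I -> I -> R) (y : I -> R) :=
  \sum_i \sum_j A i j * y i * y j.

Lemma qformT {R : realType} {I : finType} (A : I -> I -> R) y :
  qform [set: I]%SET A y = quad A y.
Proof.
by apply: eq_big => [i|i _]; rewrite ?inE//; apply: eq_bigl => j; rewrite inE.
Qed.

Section gaussian_quadratic_forms.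
Context {R : realType} {d : measure_display} {T : measurableType d}.
Context {P : probability T R} {I : finType} {Y : I -> {RV P >-> R}}.
Context {M : I -> R} {s : R}.
Hypotheses (indY : mutually_independent Y) (s0 : 0 < s).
Hypothesis lawY : forall i, has_normal_law (Y i) (M i) s.

Let X i w := (Y i w - M i) / s.

Let mX i : measurable_fun setT (X i).
Proof. by apply: measurable_funM => //; exact: measurable_funB. Qed.

Lemma coord_measurable_others i j : j != i ->
  @measurable_fun _ _ (g_sigma_algebraType (other_cylinders (Y := Y) i)) R
    setT (X j).
Proof.
move=> ji; apply: measurable_funM => //; apply: measurable_funB => //.
move=> _ B mB; rewrite setTI; apply: sub_sigma_algebra.
exists (fun k => if k == j then B else setT); first by move=> k; case: ifP.
apply/seteqP; split => [w Bw k _|w]; first by rewrite /=; case: eqP => // ->.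
by move=> /(_ j) /=; rewrite eqxx; apply; rewrite !inE.
Qed.

(** Induction on the size of [J]. Integrating out one coordinate produces the factor
    [(Num.sqrt (1 - A i i))^-1] and replaces [A] by its Schur complement; [schur_bound] preserves
    the hypothesis and [schur_mgf_bound] closes the estimate. *)
Lemma gaussian_qform_mgf (J : {set I}) (A : I -> I -> R) :
  (forall i j, A i j = A j i) ->
  (forall y, qform J A y <= 1 / 4 * \sum_(j in J) y j ^+ 2) ->
  (\int[P]_w (expR (qform J A (X ^~ w) / 2))%:E <=
   (expR ((\sum_(j in J) A j j) / 2 +
          (\sum_(j in J) \sum_(k in J) A j k ^+ 2) / 2))%:E)%E.
Proof.
move: {2}#|J| (leqnn #|J|) => n; elim: n J A => [|n IHn] J A.
  rewrite leqn0 cards_eq0 => /eqP -> _ _; rewrite /qform.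
  under eq_integral do rewrite big_set0 mul0r expR0.
  by rewrite integral_cst//= probability_setT !big_set0 mul0r addr0 expR0 mule1.
have [->|[i iJ]] := set_0Vmem J.
  by move=> _; apply: IHn; rewrite cards0.
move=> Jn sA H; have t1 : 1 / 4 < 1 :> R by lra.
have [a1 H'] := schur_bound iJ sA t1 H.
have a0 : 0 < 1 - A i i by lra.
have sq0 : 0 <= (Num.sqrt (1 - A i i))^-1 by rewrite invr_ge0 sqrtr_ge0.
apply: le_trans (_ : _ <= ((Num.sqrt (1 - A i i))^-1)%:E *
    \int[P]_w (expR (qform (J :\ i) (schur A i) (X ^~ w) / 2))%:E)%E _; last first.
  apply: le_trans (lee_wpmul2l _ (IHn _ _ _ (schur_sym _ sA) H')) _.
  - by rewrite lee_fin.
  - by move: Jn; rewrite (cardsD1 i) iJ.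
  - by rewrite -EFinM lee_fin; exact: schur_mgf_bound.
(* The coefficient of the linear term in coordinate [i], and half the form in the remaining
   coordinates. *)
pose V w := (\sum_(j in J :\ i) A i j * X j w, qform (J :\ i) A (X ^~ w) / 2).
pose f (z : R * (R * R)) := (expR z.2.2 * expR (A i i / 2 * ((z.1 - M i) / s) ^+ 2 +
   z.2.1 * ((z.1 - M i) / s)))%:E.
have mf : measurable_fun setT f.
  apply/measurable_EFinP; apply: measurable_funM.
    apply: measurableT_comp => //.
    by apply: measurableT_comp => //; exact: measurable_snd.
  apply: measurableT_comp => //.
  have mz : measurable_fun setT (fun z : R * (R * R) => (z.1 - M i) / s).
    by apply: measurable_funM => //; exact: measurable_funB.
  apply: measurable_funD; first by apply: measurable_funM => //; exact: measurable_funX.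
  by apply: measurable_funM => //; apply: measurableT_comp => //; exact: measurable_snd.
have f0 z : (0 <= f z)%E by rewrite lee_fin mulr_ge0 ?expR_ge0.
have sV S : measurable S -> <<s other_cylinders (Y := Y) i >> (V @^-1` S).
  move=> mS; have mV : @measurable_fun _ _
      (g_sigma_algebraType (other_cylinders (Y := Y) i)) (R * R)%type setT V.
    have mo j : j \in J :\ i -> @measurable_fun _ _
        (g_sigma_algebraType (other_cylinders (Y := Y) i)) R setT (X j).
      by rewrite in_setD1 => /andP[ji _]; exact: coord_measurable_others.
    apply/measurable_fun_pair; last first.
      by apply: measurable_funM => //; exact: measurable_qform.
    by apply: measurable_sum_in => j jJ; apply: measurable_funM => //; exact: mo.
  by have := mV measurableT S mS; rewrite setTI.
rewrite (_ : \int[P]_w _ = \int[P]_w f (Y i w, V w))%E; last first.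
  apply: eq_integral => w _; rewrite /f/= -expRD (qform_setD1 _ iJ sA).
  by congr (expR _)%:E; rewrite -/(X i w); field.
rewrite (coord_indep_fubini indY sV mf f0).
rewrite -ge0_integralZl//; last first.
  apply/measurable_EFinP; apply: measurableT_comp => //.
  by apply: measurable_funM => //; apply: measurable_qform => j _.
rewrite le_eqVlt; apply/orP; left; apply/eqP; apply: eq_integral => w _.
rewrite (ge0_integral_normal_law (lawY i))//; last first.
  by apply: measurableT_comp => //; exact: measurable_pair2.
rewrite /f/=; under eq_integral do rewrite EFinM.
rewrite ge0_integralZl//; last first.
  by apply/measurable_EFinP; exact: measurable_expR_quad.
rewrite (integral_normal_prob_expR_quad (M i) _ s0); last by lra.
rewrite -!EFinM; congr EFin; rewrite mulrCA -expRD; congr (_ * expR _).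
by rewrite qform_schur; field; rewrite gt_eqF.
Qed.

(** Exponential Markov inequality with parameter [l / 2]. The bound 2 on the form and [l <= 1 / 8]
    give the 1/4 required by [gaussian_qform_mgf], and the trace cancels against the centring. *)
Lemma gaussian_quad_chernoff (A : I -> I -> R) (l F t : R) :
  (forall i j, A i j = A j i) ->
  (forall y, quad A y <= 2 * \sum_j y j ^+ 2) ->
  \sum_i \sum_j A i j ^+ 2 <= F ^+ 2 -> 0 <= l <= 1 / 8 ->
  (P [set w | \sum_i A i i + t < quad A (X ^~ w)]%R <=
   (expR ((l ^+ 2 * F ^+ 2 - l * t) / 2))%:E)%E.
Proof.
move=> sA A2 AF /andP[l0 l8]; set B := [set w | _].
have mq : measurable_fun setT (fun w => quad A (X ^~ w)).
  by under eq_fun do rewrite -qformT; apply: measurable_qform => j _.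
have mB : measurable B.
  rewrite (_ : B = [set: T] `&` (fun w => quad A (X ^~ w)) @^-1`
      `](\sum_i A i i + t), +oo[); last first.
    by rewrite setTI; apply/seteqP; split => w; rewrite /B/= in_itv/= andbT.
  exact: mq.
pose lA i j := l * A i j.
have lAE y : qform [set: I]%SET lA y = l * quad A y.
  rewrite qformT /quad mulr_sumr; apply: eq_bigr => i _; rewrite mulr_sumr.
  by apply: eq_bigr => j _; rewrite /lA !mulrA.
have mE : measurable_fun setT (fun w => expR (l * quad A (X ^~ w) / 2)).
  by apply: measurableT_comp => //; do 2 apply: measurable_funM => //.
have mgf : (\int[P]_w (expR (l * quad A (X ^~ w) / 2))%:E <=
    (expR ((l * \sum_i A i i) / 2 + (l ^+ 2 * F ^+ 2) / 2))%:E)%E.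
  have slA i j : lA i j = lA j i by rewrite /lA sA.
  have blA y : qform [set: I]%SET lA y <= 1 / 4 * \sum_(j in [set: I]%SET) y j ^+ 2.
    rewrite lAE (eq_bigl xpredT); last by move=> j; rewrite inE.
    have := A2 y; have : 0 <= \sum_j y j ^+ 2 by apply: sumr_ge0 => j _; rewrite sqr_ge0.
    nra.
  have := gaussian_qform_mgf slA blA; under eq_integral do rewrite lAE.
  move/le_trans; apply; rewrite lee_fin ler_expR.
  rewrite (eq_bigl xpredT); last by move=> j; rewrite inE.
  rewrite /lA -mulr_sumr lerD2l ler_pM2r//.
  apply: le_trans (ler_wpM2l (sqr_ge0 l) AF).
  rewrite mulr_sumr (eq_bigl xpredT); last by move=> j; rewrite inE.
  apply: ler_sum => i _; rewrite mulr_sumr (eq_bigl xpredT); last by move=> j; rewrite inE.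
  by apply: ler_sum => j _; rewrite exprMn.
set q := \sum_i A i i + t in B mB *.
have -> : P B = (\int[P]_w (\1_B w)%:E)%E by rewrite integral_indic// setIT.
apply: le_trans (_ : _ <= \int[P]_w ((expR (- (l * q / 2)))%:E *
    (expR (l * quad A (X ^~ w) / 2))%:E))%E _.
  apply: ge0_le_integral => //.
  - by apply/measurable_EFinP.
  - by apply/measurable_EFinP; exact: measurable_funM.
  - move=> w _; rewrite -EFinM -expRD lee_fin indicE.
    case: (boolP (w \in B)) => [/set_mem Bw|_]; last exact: expR_ge0.
    rewrite -[leLHS]expR0 ler_expR.
    have : 0 <= l * (quad A (X^~ w) - q) by rewrite mulr_ge0// subr_ge0 ltW.
    lra.
rewrite ge0_integralZl//; last first.
  by apply/measurable_EFinP.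
apply: le_trans (lee_wpmul2l _ mgf) _; first by rewrite lee_fin expR_ge0.
by rewrite -EFinM -expRD lee_fin ler_expR /q; lra.
Qed.

Lemma gaussian_quad_tail (A : I -> I -> R) (F tau : R) :
  (forall i j, A i j = A j i) ->
  (forall y, quad A y <= 2 * \sum_j y j ^+ 2) ->
  \sum_i \sum_j A i j ^+ 2 <= F ^+ 2 -> 0 <= F -> 0 <= tau ->
  (P [set w | \sum_i A i i + (3 * F * Num.sqrt tau + 16 * tau)
              < quad A (X ^~ w)]%R <= (expR (- tau))%:E)%E.
Proof.
move=> sA A2 AF F0 tau0.
set r := Num.sqrt tau; have r0 : 0 <= r by rewrite sqrtr_ge0.
have -> : tau = r ^+ 2 by rewrite sqr_sqrtr.
(* The parameter [r / F] is admissible only for [8 * r <= F]. When [F <= 8 * r] the parameter 1/8 is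
   used, and the term [16 * tau] supplies the whole exponent. *)
have [Fr|Fr] := lerP F (8 * r).
  have l8 : 0 <= (1 / 8 : R) <= 1 / 8 by lra.
  apply: le_trans (gaussian_quad_chernoff _ sA A2 AF l8) _.
  rewrite lee_fin ler_expR; nra.
have F1 : 0 < F by lra.
have l8 : 0 <= r / F <= 1 / 8.
  by rewrite divr_ge0//= ler_pdivrMr//; lra.
apply: le_trans (gaussian_quad_chernoff _ sA A2 AF l8) _.
rewrite lee_fin ler_expR.
have -> : (r / F) ^+ 2 * F ^+ 2 - r / F * (3 * F * r + 16 * r ^+ 2) =
  - 2 * r ^+ 2 - 16 * (r ^+ 3 / F) by field; rewrite gt_eqF.
have : 0 <= r ^+ 3 / F by rewrite divr_ge0// exprn_ge0.
lra.
Qed.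

End gaussian_quadratic_forms.

(** * Projections and the gap of the criterion *)

Section projections.
Context {R : realType}.

Definition is_proj (I : finType) (A : I -> I -> R) :=
  (forall i j, A i j = A j i) /\ (forall i j, \sum_k A i k * A k j = A i j).

Lemma quadB (I : finType) (A B : I -> I -> R) y :
  quad (fun i j => A i j - B i j) y = quad A y - quad B y.
Proof.
rewrite /quad -sumrB; apply: eq_bigr => i _; rewrite -sumrB.
by apply: eq_bigr => j _; rewrite !mulrBl.
Qed.

Lemma quad_proj (I : finType) (A : I -> I -> R) y : is_proj A ->
  quad A y = \sum_k (\sum_j A k j * y j) ^+ 2.
Proof.
move=> [sA iA]; rewrite /quad.
under [RHS]eq_bigr => k _ do rewrite expr2 mulr_suml.
rewrite [RHS]exchange_big; apply: eq_bigr => i _ /=.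
under [RHS]eq_bigr => k _ do rewrite mulr_sumr.
rewrite [RHS]exchange_big; apply: eq_bigr => j _ /=.
rewrite -iA !mulr_suml; apply: eq_bigr => k _.
by rewrite (sA i k); ring.
Qed.

Lemma quad_proj_ge0 (I : finType) (A : I -> I -> R) y : is_proj A ->
  0 <= quad A y.
Proof. by move=> pA; rewrite quad_proj//; apply: sumr_ge0 => k _; exact: sqr_ge0. Qed.

Lemma proj_residual (I : finType) (A : I -> I -> R) y : is_proj A ->
  \sum_i (y i - \sum_j A i j * y j) ^+ 2 = \sum_i y i ^+ 2 - quad A y.
Proof.
move=> pA; have E : quad A y = \sum_i y i * \sum_j A i j * y j.
  by apply: eq_bigr => i _; rewrite mulr_sumr; apply: eq_bigr => j _; ring.
under eq_bigr => i _ do rewrite sqrrB.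
rewrite big_split sumrB -quad_proj//= sumrMnl -E; ring.
Qed.

Lemma quad_proj_le (I : finType) (A : I -> I -> R) y : is_proj A ->
  quad A y <= \sum_i y i ^+ 2.
Proof.
move=> pA; rewrite -subr_ge0 -proj_residual//.
by apply: sumr_ge0 => k _; exact: sqr_ge0.
Qed.

Lemma proj_frob (I : finType) (A : I -> I -> R) : is_proj A ->
  \sum_i \sum_j A i j ^+ 2 = \sum_i A i i.
Proof.
move=> [sA iA]; apply: eq_bigr => i _; rewrite -iA; apply: eq_bigr => j _.
by rewrite expr2 {2}sA.
Qed.

Lemma proj_dist (I : finType) (A B : I -> I -> R) : is_proj A -> is_proj B ->
  \sum_i \sum_j (A i j - B i j) ^+ 2 =
  \sum_i A i i + \sum_i B i i - 2 * \sum_i \sum_j A i j * B i j.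
Proof.
move=> pA pB; rewrite -!proj_frob// mulr_sumr -big_split -sumrB.
apply: eq_bigr => i _; rewrite mulr_sumr -big_split -sumrB /=.
by apply: eq_bigr => j _; ring.
Qed.

Definition kron (I J : finType) (A : I -> I -> R) (B : J -> J -> R)
  (u v : I * J) : R := A u.1 v.1 * B u.2 v.2.

Lemma sum_pair (I J : finType) (F : I * J -> R) :
  \sum_u F u = \sum_i \sum_j F (i, j).
Proof. by rewrite pair_bigA; apply: eq_bigr => -[]. Qed.

Lemma sum_kron (I J : finType) (F : I -> R) (G : J -> R) :
  \sum_(u : I * J) F u.1 * G u.2 = (\sum_i F i) * \sum_j G j.
Proof.
by rewrite sum_pair mulr_suml; apply: eq_bigr => i _; rewrite mulr_sumr.
Qed.

Lemma kron_proj (I J : finType) (A : I -> I -> R) (B : J -> J -> R) :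
  is_proj A -> is_proj B -> is_proj (kron A B).
Proof.
move=> [sA iA] [sB iB]; split=> u v; first by rewrite /kron sA sB.
rewrite /kron -iA -iB -sum_kron; apply: eq_bigr => w _; ring.
Qed.

Lemma kron_trace (I J : finType) (A : I -> I -> R) (B : J -> J -> R) :
  \sum_u kron A B u u = (\sum_i A i i) * \sum_j B j j.
Proof. by rewrite -sum_kron. Qed.

Lemma kron_frob (I J : finType) (A : I -> I -> R) (B : J -> J -> R) :
  \sum_u \sum_v kron A B u v ^+ 2 =
  (\sum_i \sum_i' A i i' ^+ 2) * \sum_j \sum_j' B j j' ^+ 2.
Proof.
rewrite -sum_kron; apply: eq_bigr => u _; rewrite -sum_kron.
by apply: eq_bigr => v _; rewrite exprMn.
Qed.

Lemma quad_kronBl (I J : finType) (A A' : I -> I -> R) (B : J -> J -> R) y :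
  quad (kron (fun i j => A i j - A' i j) B) y =
  quad (kron A B) y - quad (kron A' B) y.
Proof.
rewrite -quadB; apply: eq_bigr => u _; apply: eq_bigr => v _.
by rewrite /kron mulrBl.
Qed.

Lemma quad_kronBr (I J : finType) (A : I -> I -> R) (B B' : J -> J -> R) y :
  quad (kron A (fun i j => B i j - B' i j)) y =
  quad (kron A B) y - quad (kron A B') y.
Proof.
rewrite -quadB; apply: eq_bigr => u _; apply: eq_bigr => v _.
by rewrite /kron mulrBr.
Qed.

Lemma quad_kronC (I J : finType) (A : I -> I -> R) (B : J -> J -> R) y :
  quad (kron A B) y = quad (kron B A) (fun u => y (u.2, u.1)).
Proof.
rewrite /quad !sum_pair exchange_big; apply: eq_bigr => j _ /=.
apply: eq_bigr => i _; rewrite !sum_pair exchange_big; apply: eq_bigr => j' _ /=.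
by apply: eq_bigr => i' _; rewrite /kron/= [A _ _ * _]mulrC.
Qed.

(* Averaging along the second coordinate as well only shrinks the norm. *)
Lemma quad_kron_le (I J : finType) (A : I -> I -> R) (B : J -> J -> R) y :
  is_proj A -> is_proj B ->
  quad (kron A B) y <= \sum_j quad A (fun i => y (i, j)).
Proof.
move=> pA pB.
have -> : quad (kron A B) y =
    \sum_k quad B (fun j => \sum_i A k i * y (i, j)).
  rewrite quad_proj; last exact: kron_proj.
  rewrite sum_pair; apply: eq_bigr => k _.
  rewrite quad_proj//; apply: eq_bigr => l _; congr (_ ^+ 2).
  rewrite sum_pair exchange_big; apply: eq_bigr => j _ /=.
  by rewrite mulr_sumr; apply: eq_bigr => i _; rewrite /kron/=; ring.
under [leRHS]eq_bigr => j _ do rewrite quad_proj//.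
rewrite [leRHS]exchange_big; apply: ler_sum => k _; exact: quad_proj_le.
Qed.

Lemma quad_shift (I : finType) (A : I -> I -> R) (y x : I -> R) (s : R) :
  (forall i j, A i j = A j i) ->
  quad A (fun i => y i + s * x i) =
  quad A y + 2 * s * \sum_i (\sum_j A i j * y j) * x i + s ^+ 2 * quad A x.
Proof.
move=> sA; have E : \sum_i (\sum_j A i j * y j) * x i =
    \sum_i \sum_j A i j * y j * x i.
  by apply: eq_bigr => i _; rewrite mulr_suml.
have E' : \sum_i (\sum_j A i j * y j) * x i = \sum_i \sum_j A i j * y i * x j.
  rewrite E exchange_big; apply: eq_bigr => i _; apply: eq_bigr => j _ /=.
  by rewrite sA.
transitivity (quad A y + s * (\sum_i (\sum_j A i j * y j) * x i +
    \sum_i (\sum_j A i j * y j) * x i) + s ^+ 2 * quad A x); last by ring.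
rewrite {1}E E' /quad -big_split mulr_sumr -big_split mulr_sumr -big_split.
apply: eq_bigr => i _ /=.
rewrite -big_split mulr_sumr -big_split mulr_sumr -big_split.
by apply: eq_bigr => j _ /=; ring.
Qed.

Definition residual (I : finType) (A : I -> I -> R) (y : I -> R) i :=
  y i - \sum_j A i j * y j.

(* Division by 0 gives 0, so [rank1 v] is null when [v] is. *)
Definition rank1 (I : finType) (v : I -> R) (i j : I) : R :=
  v i * v j / \sum_k v k ^+ 2.

Lemma quad_rank1 (I : finType) (v y : I -> R) :
  quad (rank1 v) y = (\sum_i v i * y i) ^+ 2 / \sum_k v k ^+ 2.
Proof.
rewrite expr2 /quad !mulr_suml; apply: eq_bigr => i _.
rewrite mulr_sumr mulr_suml; apply: eq_bigr => j _; rewrite /rank1; ring.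
Qed.

Lemma rank1_sym (I : finType) (v : I -> R) i j : rank1 v i j = rank1 v j i.
Proof. by rewrite /rank1 [v i * _]mulrC. Qed.

Lemma sumr_sqr_ge0 (I : finType) (v : I -> R) : 0 <= \sum_k v k ^+ 2.
Proof. by apply: sumr_ge0 => k _; exact: sqr_ge0. Qed.

(** Lagrange's identity: the difference of the two sides is half a double sum of squares. *)
Lemma cauchy_schwarz_sum (I : finType) (v y : I -> R) :
  (\sum_i v i * y i) ^+ 2 <= (\sum_i v i ^+ 2) * \sum_i y i ^+ 2.
Proof.
rewrite -subr_ge0.
have : 0 <= \sum_i \sum_j (v i * y j - v j * y i) ^+ 2.
  by apply: sumr_ge0 => i _; apply: sumr_ge0 => j _; exact: sqr_ge0.
have -> : \sum_i \sum_j (v i * y j - v j * y i) ^+ 2 =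
  2 * ((\sum_i v i ^+ 2) * (\sum_i y i ^+ 2) - (\sum_i v i * y i) ^+ 2).
  transitivity ((\sum_i v i ^+ 2) * (\sum_i y i ^+ 2) +
    (\sum_i y i ^+ 2) * (\sum_i v i ^+ 2) - 2 * ((\sum_i v i * y i) * (\sum_i v i * y i))); last by ring.
  rewrite !mulr_suml mulr_sumr -big_split -sumrB; apply: eq_bigr => i _ /=.
  rewrite !mulr_sumr -big_split -sumrB; apply: eq_bigr => j _ /=; ring.
by rewrite pmulr_rge0.
Qed.

Lemma quad_rank1_le (I : finType) (v y : I -> R) :
  quad (rank1 v) y <= \sum_i y i ^+ 2.
Proof.
rewrite quad_rank1; have := sumr_sqr_ge0 v; rewrite le_eqVlt.
case/predU1P => [<-|v0]; first by rewrite invr0 mulr0 sumr_sqr_ge0.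
by rewrite ler_pdivrMr// mulrC cauchy_schwarz_sum.
Qed.

Lemma rank1_trace (I : finType) (v : I -> R) : \sum_i rank1 v i i <= 1.
Proof.
rewrite -mulr_suml; have := sumr_sqr_ge0 v; rewrite le_eqVlt.
case/predU1P => [<-|v0]; first by rewrite invr0 mulr0 ler01.
by rewrite (eq_bigr (fun k => v k ^+ 2)) ?divff ?gt_eqF.
Qed.

Lemma rank1_frob (I : finType) (v : I -> R) :
  \sum_i \sum_j rank1 v i j ^+ 2 <= 1.
Proof.
have -> : \sum_i \sum_j rank1 v i j ^+ 2 =
    ((\sum_i v i ^+ 2) / \sum_k v k ^+ 2) ^+ 2.
  rewrite expr2 !mulr_suml; apply: eq_bigr => i _.
  rewrite mulr_sumr; apply: eq_bigr => j _; rewrite /rank1; ring.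
have := sumr_sqr_ge0 v; rewrite le_eqVlt.
case/predU1P => [<-|v0]; first by rewrite invr0 mulr0 expr0n ler01.
by rewrite divff ?gt_eqF// expr1n.
Qed.

(* AM-GM absorbs the linear term into half of the signal. *)
Lemma linear_term_ge (I : finType) (v x : I -> R) (s : R) :
  - ((\sum_i v i ^+ 2) / 2 + 2 * s ^+ 2 * quad (rank1 v) x) <=
  2 * s * \sum_i v i * x i.
Proof.
rewrite quad_rank1; set t := \sum_i v i * x i.
have := sumr_sqr_ge0 v; rewrite le_eqVlt => /predU1P[v0|v0].
  have t0 : t = 0.
    have := cauchy_schwarz_sum v x; rewrite -v0 mul0r -/t.
    by move=> t2; apply/eqP; rewrite -sqrf_eq0 eq_le t2 sqr_ge0.
  by rewrite -v0 t0 invr0; lra.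
set S := \sum_k v k ^+ 2 in v0 *.
have : 0 <= (S + 2 * s * t) ^+ 2 / (2 * S).
  by rewrite divr_ge0 ?sqr_ge0// mulr_ge0// ltW.
have -> : (S + 2 * s * t) ^+ 2 / (2 * S) =
  S / 2 + 2 * s * t + 2 * s ^+ 2 * (t ^+ 2 / S) by field; rewrite gt_eqF.
lra.
Qed.

(* The last three forms add up to that of [kron A B - kron A0 B0]. *)
Lemma crit_gap_ge (I J : finType) (A A0 : I -> I -> R) (B B0 : J -> J -> R)
    (M x : I * J -> R) (s : R) :
  is_proj A -> is_proj A0 -> is_proj B -> is_proj B0 ->
  (forall u, \sum_v kron A0 B0 u v * M v = M u) ->
  let Q := kron A B in
  let S := \sum_u M u ^+ 2 - quad Q M in
  S / 2 - s ^+ 2 * (2 * quad (rank1 (residual Q M)) x +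
    quad (kron (fun i j => A i j - A0 i j) B0) x +
    quad (kron A0 (fun i j => B i j - B0 i j)) x +
    quad (kron (fun i j => A i j - A0 i j) (fun i j => B i j - B0 i j)) x) <=
  quad (kron A0 B0) (fun u => M u + s * x u) - quad Q (fun u => M u + s * x u).
Proof.
move=> pA pA0 pB pB0 HM; cbv zeta; set Q := kron A B; set S := \sum_u M u ^+ 2 - quad Q M.
have pQ : is_proj Q by exact: kron_proj.
have pQ0 : is_proj (kron A0 B0) by exact: kron_proj.
rewrite !quad_kronBl !quad_kronBr -/Q !quad_shift; [|by case: pQ|by case: pQ0].
have SE : S = \sum_u residual Q M u ^+ 2 by rewrite /S -proj_residual.
have -> : quad (kron A0 B0) M = \sum_u M u ^+ 2.
  by rewrite quad_proj//; apply: eq_bigr => u _; rewrite HM.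
have := linear_term_ge (residual Q M) x s; rewrite -SE.
(* The true projection fixes [M], so the difference of the two linear terms is the scalar product of
   [x] with the residual. *)
have -> : \sum_i residual Q M i * x i =
   \sum_i (\sum_j kron A0 B0 i j * M j) * x i - \sum_i (\sum_j Q i j * M j) * x i.
  by rewrite -sumrB; apply: eq_bigr => u _; rewrite HM /residual; ring.
by rewrite /S; lra.
Qed.

End projections.

(** * Averaging projections of labellings *)

Section labellings.
Context {R : realType} {I : finType}.

(** Class sizes are real sums of indicators, so that they can be exchanged with other sums. *)
Definition csize (C : finType) (g : I -> C) (k : C) : R :=
  \sum_x (g x == k)%:R.

(** The orthogonal projection that averages over the classes of [g]. *)
Definition pmat (C : finType) (g : I -> C) (i j : I) : R :=
  (g i == g j)%:R / csize g (g i).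

Definition mismatch (C : finType) (g g0 : I -> C) : nat :=
  #|[set i | g i != g0 i]%SET|.

Lemma mismatchE (C : finType) (g g0 : I -> C) :
  (mismatch g g0)%:R = \sum_i (g i != g0 i)%:R :> R.
Proof.
rewrite /mismatch -sum1_card natr_sum [LHS]big_mkcond; apply: eq_bigr => i _.
by rewrite inE; case: (_ != _).
Qed.

Lemma csize_ge0 (C : finType) (g : I -> C) k : 0 <= csize g k.
Proof. by apply: sumr_ge0. Qed.

Lemma csize_gt0 (C : finType) (g : I -> C) i : 0 < csize g (g i).
Proof.
rewrite /csize (bigD1 i)//= eqxx ltr_pwDl//.
by apply: sumr_ge0.
Qed.

(** Averaging fixes every function of the label. Unit row sums, idempotence and the invariance of
    the mean matrix are all instances. *)
Lemma pmat_sum (C : finType) (g : I -> C) (F : C -> R) i :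
  \sum_j pmat g i j * F (g j) = F (g i).
Proof.
transitivity (\sum_j (g j == g i)%:R * (F (g i) / csize g (g i))).
  apply: eq_bigr => j _; rewrite /pmat eq_sym.
  by case: eqP => [->|_]; rewrite ?mul0r// !mul1r mulrC.
by rewrite -mulr_suml -/(csize g (g i)) mulrC divfK// gt_eqF// csize_gt0.
Qed.

Lemma pmat_sum1 (C : finType) (g : I -> C) i : \sum_j pmat g i j = 1.
Proof. by have := pmat_sum g (fun=> 1) i; under eq_bigr do rewrite mulr1. Qed.

Lemma pmat_sym (C : finType) (g : I -> C) i j : pmat g i j = pmat g j i.
Proof. by rewrite /pmat [g j == _]eq_sym; case: eqP => [->//|]; rewrite !mul0r. Qed.

Lemma pmat_ge0 (C : finType) (g : I -> C) i j : 0 <= pmat g i j.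
Proof. by rewrite divr_ge0// csize_ge0. Qed.

Lemma pmat_proj (C : finType) (g : I -> C) : is_proj (pmat g).
Proof.
split=> i j; first exact: pmat_sym.
exact: (pmat_sum g (fun k => (k == g j)%:R / csize g k)).
Qed.

Lemma sum_by_label (C : finType) (g : I -> C) (F : C -> R) :
  \sum_i F (g i) = \sum_k csize g k * F k.
Proof.
rewrite /csize; under [RHS]eq_bigr do rewrite mulr_suml.
rewrite [RHS]exchange_big; apply: eq_bigr => i _ /=.
rewrite (bigD1 (g i))//= eqxx mul1r big1 ?addr0// => k /negPf ki.
by rewrite eq_sym ki mul0r.
Qed.

Lemma pmat_trace (C : finType) (g : I -> C) : (forall k, exists i, g i = k) ->
  \sum_i pmat g i i = #|C|%:R.
Proof.
move=> sg; rewrite (eq_bigr (fun i => (csize g (g i))^-1)); last first.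
  by move=> i _; rewrite /pmat eqxx mul1r.
rewrite (sum_by_label g (fun k => (csize g k)^-1)).
rewrite (eq_bigr (fun=> 1)) ?sumr_const// => k _.
by have [i <-] := sg k; rewrite divff// gt_eqF// csize_gt0.
Qed.

Definition common (C : finType) (g g0 : I -> C) (k : C) : R :=
  \sum_x ((g x == k) && (g0 x == k))%:R.

Lemma common_le (C : finType) (g g0 : I -> C) k : common g g0 k <= csize g k.
Proof. by apply: ler_sum => x _; case: (_ == _); case: (_ == _). Qed.

Lemma common_ge0 (C : finType) (g g0 : I -> C) k : 0 <= common g g0 k.
Proof. by apply: sumr_ge0. Qed.

Lemma commonC (C : finType) (g g0 : I -> C) k : common g g0 k = common g0 g k.
Proof. by apply: eq_bigr => x _; rewrite andbC. Qed.

Lemma sum_csizeB_common (C : finType) (g g0 : I -> C) :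
  \sum_k (csize g k - common g g0 k) = (mismatch g g0)%:R.
Proof.
rewrite mismatchE; under eq_bigr do rewrite -sumrB.
rewrite exchange_big; apply: eq_bigr => i _ /=.
rewrite (bigD1 (g i))//= eqxx big1 => [|k /negPf ki].
  by rewrite addr0 eq_sym; case: (_ == _); rewrite /= ?subrr ?subr0.
by rewrite [g i == k]eq_sym ki subr0.
Qed.

Lemma mismatchC (C : finType) (g g0 : I -> C) : mismatch g g0 = mismatch g0 g.
Proof. by apply: eq_card => i; rewrite !inE eq_sym. Qed.

(** Only pairs of points carrying one and the same label under both labellings are kept; the other
    products are nonnegative. *)
Lemma pmat_overlap_ge (C : finType) (g g0 : I -> C) :
  \sum_k common g g0 k ^+ 2 / (csize g k * csize g0 k) <=
  \sum_i \sum_j pmat g i j * pmat g0 i j.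
Proof.
have -> : \sum_k common g g0 k ^+ 2 / (csize g k * csize g0 k) =
  \sum_i \sum_j \sum_k ((g i == k) && (g0 i == k))%:R *
    ((g j == k) && (g0 j == k))%:R / (csize g k * csize g0 k).
  under [RHS]eq_bigr do rewrite exchange_big/=.
  rewrite [RHS]exchange_big; apply: eq_bigr => k _ /=.
  rewrite expr2 !mulr_suml; apply: eq_bigr => i _.
  by rewrite mulr_sumr mulr_suml.
apply: ler_sum => i _; apply: ler_sum => j _.
rewrite (bigD1 (g i))//= eqxx big1 => [|k /negPf ki]; last first.
  by rewrite eq_sym ki !mul0r.
rewrite addr0 /pmat; have [e0|] := eqVneq (g0 i) (g i); last first.
  by rewrite !mul0r => _; rewrite mulr_ge0 ?pmat_ge0//; exact: pmat_ge0.
rewrite e0 [g i == g j]eq_sym [g i == g0 j]eq_sym.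
by do 2 case: (_ == _); rewrite /= ?(mul0r, mulr0, mul1r)// -invfM.
Qed.

(** By the overlap bound the distance is at most twice a sum over the classes of
    [1 - a ^+ 2 / (B * c)], where [B] and [c] are the two sizes and [a] the common part. Each term
    is at most [3 / c * ((B - a) + (c - a))], and [B - a] and [c - a] each sum to the mismatch: 12
    is 2 times 3 times 2. *)
Lemma pmat_dist_le (C : finType) (g g0 : I -> C) (b : R) :
  (forall k, exists i, g i = k) -> (forall k, exists i, g0 i = k) ->
  0 < b -> (forall k, b <= csize g0 k) ->
  \sum_i \sum_j (pmat g i j - pmat g0 i j) ^+ 2 <= 12 * (mismatch g g0)%:R / b.
Proof.
move=> sg sg0 b0 bg0.
rewrite proj_dist; [|exact: pmat_proj..]; rewrite !pmat_trace//.
have H := pmat_overlap_ge g g0.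
apply: le_trans (_ : _ <= 2 * \sum_k (1 - common g g0 k ^+ 2 /
    (csize g k * csize g0 k))) _.
  by rewrite sumrB sumr_const; lra.
apply: le_trans (_ : 2 * \sum_k (3 / b * ((csize g k - common g g0 k) +
    (csize g0 k - common g0 g k))) <= _); last first.
  rewrite -mulr_sumr big_split/= !sum_csizeB_common [mismatch g0 g]mismatchC.
  by rewrite le_eqVlt; apply/orP; left; apply/eqP; ring.
rewrite ler_pM2l//; apply: ler_sum => k _.
have [i gi] := sg k; have B0 : 0 < csize g k by rewrite -gi csize_gt0.
have C0 : 0 < csize g0 k by apply: lt_le_trans b0 _.
have := common_le g g0 k; have := common_le g0 g k; have := common_ge0 g g0 k.
rewrite [common g0 g k]commonC.
move: (bg0 k) B0 C0; move: (csize g k) (csize g0 k) (common g g0 k) => B c a.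
move=> bc B0 C0 a0 ac aB.
apply: le_trans (_ : 3 / c * (B - a + (c - a)) <= _); last first.
  apply: ler_wpM2r; first by rewrite addr_ge0 ?subr_ge0.
  by rewrite ler_pM2l// lef_pV2.
have -> : 1 - a ^+ 2 / (B * c) = (B * c - a ^+ 2) / B / c.
  by field; rewrite !gt_eqF.
have -> : 3 / c * (B - a + (c - a)) = 3 * (B - a + (c - a)) / c by ring.
rewrite ler_pM2r ?invr_gt0// ler_pdivrMr//.
have u0 : 0 <= B - a by rewrite subr_ge0.
have v0 : 0 <= c - a by rewrite subr_ge0.
nra.
Qed.

(** A bound independent of the mismatch, applied to one factor when both projections are replaced by
    differences. *)
Lemma pmat_dist_le_trace (C : finType) (g g0 : I -> C) :
  (forall k, exists i, g i = k) -> (forall k, exists i, g0 i = k) ->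
  \sum_i \sum_j (pmat g i j - pmat g0 i j) ^+ 2 <= 2 * #|C|%:R.
Proof.
move=> sg sg0; rewrite proj_dist; [|exact: pmat_proj..]; rewrite !pmat_trace//.
have : 0 <= \sum_i \sum_j pmat g i j * pmat g0 i j.
  by apply: sumr_ge0 => i _; apply: sumr_ge0 => j _; rewrite mulr_ge0 ?pmat_ge0.
lra.
Qed.

End labellings.

(** * Alignment of the labels and strength of the signal *)

Section separation.
Context {R : realType} {I : finType}.

(** The impurity of the classes of [g]. It links the two sides of the argument: it dominates the
    errors of the majority vote and is dominated by the signal. *)
Definition mixing (C D : finType) (g : I -> C) (g0 : I -> D) : R :=
  \sum_i \sum_i' pmat g i i' * (g0 i != g0 i')%:R.

(* [f] is the majority vote inside each class of [g]. *)
Lemma mixing_ge (C : finType) (g g0 : I -> C) :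
  exists f : C -> C, (mismatch (f \o g) g0)%:R <= mixing g g0.
Proof.
pose cnt a k : R := \sum_x (g0 x == k)%:R * (g x == a)%:R.
pose f a := [arg max_(k > a) cnt a k]%O.
have fP a k : cnt a k <= cnt a (f a).
  by rewrite /f; case: arg_maxP => // k' _; apply.
have PE i k : \sum_j pmat g i j * (g0 j == k)%:R = cnt (g i) k / csize g (g i).
  rewrite mulr_suml; apply: eq_bigr => j _.
  by rewrite /pmat [g j == _]eq_sym; ring.
exists f; rewrite mismatchE.
(* The error at each point is spread evenly over its class, on which [f \o g] is constant; the
   majority vote then wins row by row. *)
have -> : \sum_i ((f \o g) i != g0 i)%:R =
    \sum_i \sum_i' pmat g i i' * (f (g i) != g0 i')%:R :> R.
  rewrite [RHS]exchange_big; apply: eq_bigr => j _ /=.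
  transitivity (\sum_i pmat g j i * (f (g j) != g0 j)%:R : R).
    by rewrite -mulr_suml (pmat_sum1 (R := R)) mul1r.
  apply: eq_bigr => i _; rewrite pmat_sym /pmat.
  by case: eqP => [->//|_]; rewrite !mul0r.
apply: ler_sum => i _.
have nE k : \sum_j pmat g i j * (k != g0 j)%:R =
    1 - cnt (g i) k / csize g (g i).
  rewrite -PE -[X in X - _](pmat_sum1 g i) -sumrB; apply: eq_bigr => j _.
  by rewrite [k == _]eq_sym; case: (_ == k); rewrite /= ?mulr0 ?mulr1 ?subrr ?subr0.
by rewrite !nE lerB// ler_pM2r ?invr_gt0 ?csize_gt0.
Qed.

(* A permutation agreeing with [f] as often as possible agrees with it over
   every value of [f]: otherwise a transposition would improve it. *)
Lemma perm_agree (C : finType) (f : C -> C) : exists s : {perm C},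
  forall k, exists2 a, s a = f a & f a = f k.
Proof.
pose agree (s : {perm C}) := #|[set a | s a == f a]%SET|.
pose s := [arg max_(s > 1%g) agree s]%N.
have sP t : (agree t <= agree s)%N by rewrite /s; case: arg_maxnP => // ? _; apply.
exists s => k; pose b := (s^-1)%g (f k).
have sb : s b = f k by rewrite permKV.
have [e|ne] := eqVneq (f b) (f k); first by exists b => //; rewrite sb.
have [e|nk] := eqVneq (s k) (f k); first by exists k.
exfalso; have kb : k != b by apply: contra_neq ne => <-.
(* Exchanging [k] and [b] loses no agreement, since [s] disagrees with [f] at both, and gains the
   one at [k]. *)
have := sP (tperm k b * s)%g; rewrite leqNgt => /negP; apply.
apply: proper_card; apply/properP; split.
  apply/fintype.subsetP => a; rewrite !inE permM => /eqP sa.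
  have ak : a != k by apply: contra_neq nk => <-.
  have ab : a != b by apply: contra_neq ne => ba; rewrite -sb -ba.
  by rewrite tpermD 1?eq_sym// sa.
by exists k; rewrite inE ?permM ?tpermL ?sb.
Qed.

(** Replacing [f] by [s] costs at most [gam * b] points for each label where they differ. There are
    no more such labels than labels missed by [f], and each missed label already accounts for at
    least [b] errors of [f \o g]. *)
Lemma label_alignment (C : finType) (g g0 : I -> C) (f : C -> C) (b gam : R) :
  0 <= b -> 0 <= gam -> (forall k, b <= csize g0 k <= gam * b) ->
  exists s : {perm C}, (mismatch (s \o g) g0)%:R <=
    (1 + gam) * (mismatch (f \o g) g0)%:R :> R.
Proof.
move=> b0 gam0 bg; have [s sP] := perm_agree f; exists s.
pose miss := [set k | k \notin f @: [set: C]]%SET.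
pose dis := [set a | s a != f a]%SET.
have dm : (#|dis| <= #|miss|)%N.
  have -> : dis = (~: [set a | s a == f a])%SET by apply/setP => k; rewrite !inE.
  have -> : miss = (~: (f @: [set: C]))%SET by apply/setP => k; rewrite !inE.
  rewrite [leqLHS]cardsCs [leqRHS]cardsCs !finset.setCK leq_sub2l//.
  apply: leq_trans (leq_imset_card f _); apply: subset_leq_card.
  apply/fintype.subsetP => _ /imsetP[k _ ->]; have [a sa fa] := sP k.
  by apply/imsetP; exists a; rewrite ?inE ?sa.
have missE : #|miss|%:R * b <= (mismatch (f \o g) g0)%:R.
  apply: le_trans (_ : \sum_(k in miss) csize g0 k <= _).
    rewrite mulr_natl -sumr_const; apply: ler_sum => k _.
    by have /andP[] := bg k.
  rewrite mismatchE exchange_big; apply: ler_sum => i _ /=.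
  have [e|ne] := eqVneq (f (g i)) (g0 i).
    rewrite big1// => k; rewrite inE; case: eqP => // <- /negP[].
    by rewrite -e imset_f.
  have [h|h] := boolP (g0 i \in miss).
    rewrite (bigD1 (g0 i))//= eqxx big1 ?addr0// => k /andP[_ /negPf].
    by rewrite eq_sym => ->.
  rewrite big1// => k km; case: eqP => // e.
  by move: h; rewrite e km.
rewrite !mismatchE mulrDl mul1r.
apply: le_trans (_ : _ <= \sum_i (f (g i) != g0 i)%:R + \sum_(a in dis) csize g0 (f a)) _.
  have -> : \sum_(a in dis) csize g0 (f a) =
     \sum_i \sum_(a in dis) (g0 i == f a)%:R :> R by rewrite exchange_big.
  rewrite -big_split; apply: ler_sum => i _ /=.
  have s1 : 0 <= \sum_(a in dis) (g0 i == f a)%:R :> R by apply: sumr_ge0.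
  have [e|ne] := eqVneq (f (g i)) (g0 i); last first.
    by case: (_ != _); rewrite /= ?lerDl ?addr_ge0.
  have [_|ns] := eqVneq (s (g i)) (g0 i); first by rewrite add0r.
  rewrite add0r (bigD1 (g i)) ?inE ?e//= eqxx lerDl.
  by apply: sumr_ge0.
rewrite lerD2l -mismatchE.
apply: le_trans (_ : \sum_(a in dis) gam * b <= _).
  by apply: ler_sum => a _; have /andP[] := bg (f a).
rewrite sumr_const -[leLHS]mulr_natl [leLHS]mulrCA.
apply: le_trans (ler_wpM2l gam0 missE); rewrite ler_wpM2l//.
by rewrite ler_wpM2r// ler_nat.
Qed.

Lemma sum_sqr_diff (A : I -> I -> R) (y : I -> R) :
  (forall i j, A i j = A j i) -> (forall i, \sum_j A i j = 1) ->
  \sum_i y i ^+ 2 - quad A y =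
  (\sum_i \sum_j A i j * (y i - y j) ^+ 2) / 2.
Proof.
move=> sA A1.
have E1 : \sum_i y i ^+ 2 = \sum_i \sum_j A i j * y i ^+ 2.
  by apply: eq_bigr => i _; rewrite -mulr_suml A1 mul1r.
have E2 : \sum_i y i ^+ 2 = \sum_i \sum_j A i j * y j ^+ 2.
  rewrite E1 exchange_big; apply: eq_bigr => i _; apply: eq_bigr => j _ /=.
  by rewrite sA.
suff -> : \sum_i \sum_j A i j * (y i - y j) ^+ 2 =
  \sum_i y i ^+ 2 + \sum_i y i ^+ 2 - 2 * quad A y by field.
rewrite {1}E1 E2 /quad mulr_sumr -big_split -sumrB; apply: eq_bigr => i _ /=.
rewrite mulr_sumr -big_split -sumrB; apply: eq_bigr => j _ /=; ring.
Qed.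

(** Discarding the average along columns only lowers the residual. Each column then contributes a
    within-class variance, written through pairwise differences, to which the separation of the rows
    applies. *)
Lemma row_signal_ge (J C : finType) (g g0 : I -> C) (B : J -> J -> R)
    (M : I * J -> R) (t : R) :
  is_proj B ->
  (forall i i', g0 i != g0 i' -> t <= \sum_j (M (i, j) - M (i', j)) ^+ 2) ->
  t / 2 * mixing g g0 <= \sum_u M u ^+ 2 - quad (kron (pmat g) B) M.
Proof.
move=> pB sep; have pP := pmat_proj (R := R) g.
apply: le_trans (lerB (lexx _) (quad_kron_le M pP pB)).
rewrite sum_pair exchange_big -sumrB /=.
rewrite (eq_bigr (fun j => (\sum_i \sum_i' pmat g i i' *
    (M (i, j) - M (i', j)) ^+ 2) / 2)); last first.
  by move=> j _; apply: sum_sqr_diff; [exact: pmat_sym|exact: pmat_sum1].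
rewrite -mulr_suml mulrAC ler_pM2r ?invr_gt0// exchange_big mulr_sumr.
apply: ler_sum => i _ /=; rewrite exchange_big mulr_sumr.
apply: ler_sum => i' _ /=; rewrite -mulr_sumr mulrCA.
apply: ler_wpM2l; first exact: pmat_ge0.
have [e|ne] := eqVneq (g0 i) (g0 i').
  by rewrite mulr0; apply: sumr_ge0 => j _; exact: sqr_ge0.
by rewrite mulr1; apply: sep.
Qed.

(* The factor [1 + gam] is the cost of turning the majority vote, which need not
   be injective, into a permutation of the labels. *)
Lemma aligned_row_signal_ge (J C : finType) (g g0 : I -> C) (M : I * J -> R)
    (t b gam : R) :
  0 <= t ->
  (forall i i', g0 i != g0 i' -> t <= \sum_j (M (i, j) - M (i', j)) ^+ 2) ->
  0 <= b -> 0 <= gam -> (forall k, b <= csize g0 k <= gam * b) ->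
  exists s : {perm C}, forall B : J -> J -> R, is_proj B ->
    t / 2 * (mismatch (s \o g) g0)%:R <=
    (1 + gam) * (\sum_u M u ^+ 2 - quad (kron (pmat g) B) M).
Proof.
move=> t0 sep b0 gam0 bg.
have [f fm] := mixing_ge g g0; have [s sm] := label_alignment g f b0 gam0 bg.
exists s => B pB.
apply: le_trans (ler_wpM2l _ (row_signal_ge g pB sep)); last by lra.
rewrite mulrCA ler_wpM2l ?divr_ge0//; apply: le_trans sm _.
by rewrite ler_wpM2l//; lra.
Qed.

Lemma pmat_perm (C : finType) (g : I -> C) (s : {perm C}) i j :
  pmat (s \o g) i j = pmat g i j :> R.
Proof.
rewrite /pmat /= (inj_eq perm_inj); congr (_ / _).
by apply: eq_bigr => x _ /=; rewrite (inj_eq perm_inj).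
Qed.

End separation.

(** * Partitions and the criterion *)

Definition classes_of (T C : finType) (g : T -> C) (k : C) : {set T} :=
  [set x | g x == k]%SET.

Lemma partition_labelled (T : finType) (K : nat) (G : {set {set T}}) :
  partition_into K G -> exists B : 'I_K -> {set T}, G = unlabel B.
Proof.
move=> /andP[_ /eqP cG]; exists (fun k => enum_val (cast_ord (esym cG) k)).
apply/setP => A; apply/idP/imsetP => [AG|[k _ ->]]; last exact: enum_valP.
exists (cast_ord cG (enum_rank_in AG A)) => //.
by rewrite cast_ordK enum_rankK_in.
Qed.

(** The cardinality makes the blocks distinct, and their being nonempty makes the labelling
    surjective. A [{ffun}] is produced because the union bound sums over the finite type of
    labellings. *)
Lemma label_of_partition (T : finType) (K : nat) (B : 'I_K -> {set T}) :
  partition_into K (unlabel B) ->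
  exists g : {ffun T -> 'I_K}, (forall k, exists i, g i = k) /\
    forall k, B k = classes_of g k.
Proof.
move=> /andP[/and3P[/eqP cov triv n0] /eqP card].
have injB : injective B.
  have /imset_injP injB : #|unlabel B| == #|[set: 'I_K]%SET|.
    by rewrite card cardsT card_ord.
  by move=> k l; apply: injB; rewrite inE.
have BG k : B k \in unlabel B by apply: imset_f; rewrite inE.
have ex i : exists k, i \in B k.
  have : i \in finset.cover (unlabel B) by rewrite cov inE.
  by move=> /bigcupP[_ /imsetP[k _ ->] iB]; exists k.
have [g' gP'] := choice ex; pose g := finfun g'.
have gP i : i \in B (g i) by rewrite ffunE.
have gE i k : i \in B k -> g i = k.
  move=> iB; apply: injB; rewrite -(def_pblock triv (BG k) iB).
  by rewrite -(def_pblock triv (BG (g i)) (gP i)).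
exists g; split.
  move=> k; have : B k != finset.set0 by apply: contraNneq n0 => <-.
  by move=> /set0Pn[i iB]; exists i; exact: gE.
move=> k; apply/setP => i; rewrite inE; apply/idP/eqP => [/gE//|<-].
exact: gP.
Qed.

Section criterion.
Context {R : realType}.

Lemma card_classes_of (T C : finType) (g : T -> C) k :
  #|classes_of g k|%:R = csize g k :> R.
Proof.
rewrite -sum1_card natr_sum [LHS]big_mkcond; apply: eq_bigr => i _.
by rewrite inE; case: (_ == _).
Qed.

Lemma unlabel_classes_sum (T : finType) (K : nat) (g : T -> 'I_K)
    (F : {set T} -> R) : (forall k, exists i, g i = k) ->
  \sum_(A in unlabel (classes_of g)) F A = \sum_k F (classes_of g k).
Proof.
move=> sg; rewrite /unlabel big_imset/=.
  by apply: eq_bigl => k; rewrite inE.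
move=> k l _ _ kl; have [i gi] := sg k.
have : i \in classes_of g l by rewrite -kl inE gi.
by rewrite inE gi => /eqP.
Qed.

Lemma sum_classes_of (T C : finType) (g : T -> C) (F : C -> T -> R) :
  \sum_k \sum_(i in classes_of g k) F k i = \sum_i F (g i) i.
Proof.
rewrite (exchange_big_dep predT)//=; apply: eq_bigr => i _.
rewrite (bigD1 (g i)) ?inE//= big1 ?addr0// => k.
by rewrite inE eq_sym => /andP[/eqP-> /eqP].
Qed.

(** The block means are the entries of the doubly averaged matrix, so the criterion is the squared
    residual of a projection. *)
Lemma biKmeans_critE (n p K L : nat) (Y : 'M[R]_(n, p)) (g : 'I_n -> 'I_K)
    (h : 'I_p -> 'I_L) :
  (forall k, exists i, g i = k) -> (forall l, exists j, h j = l) ->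
  biKmeans_crit Y (unlabel (classes_of g)) (unlabel (classes_of h)) =
  \sum_i \sum_j Y i j ^+ 2 -
  quad (kron (pmat g) (pmat h)) (fun u => Y u.1 u.2).
Proof.
move=> sg sh; rewrite /biKmeans_crit unlabel_classes_sum//.
under eq_bigr do rewrite unlabel_classes_sum//.
under eq_bigr do rewrite exchange_big/=.
rewrite (sum_classes_of g (fun k i => \sum_l \sum_(j in classes_of h l)
  (Y i j - block_mean Y (classes_of g k) (classes_of h l)) ^+ 2)).
under eq_bigr => i _ do rewrite (sum_classes_of h (fun l j =>
  (Y i j - block_mean Y (classes_of g (g i)) (classes_of h l)) ^+ 2)).
rewrite -(sum_pair (fun u => Y u.1 u.2 ^+ 2)) -proj_residual; last first.
  by apply: kron_proj; exact: pmat_proj.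
rewrite sum_pair; apply: eq_bigr => i _; apply: eq_bigr => j _.
congr ((_ - _) ^+ 2); rewrite sum_pair /block_mean natrM !card_classes_of.
rewrite mulr_suml big_mkcond; apply: eq_bigr => i' _ /=.
rewrite inE [g i' == _]eq_sym /kron/= /pmat; case: (g i == g i') => /=; last first.
  by rewrite big1// => j' _; rewrite !mul0r.
rewrite mulr_suml big_mkcond; apply: eq_bigr => j' _ /=.
rewrite inE [h j' == _]eq_sym; case: (h j == h j') => /=; last by rewrite !(mul0r, mulr0).
by rewrite !mul1r invfM mulrC.
Qed.

End criterion.

(** * Union bound *)

Section union_bound.
Context {R : realType}.

(** The weight is a product over the points, so the sum factorises; each factor is at most
    [1 + #|C| * x]. *)
Lemma label_weight_sum (I C : finType) (g0 : I -> C) (x : R) : 0 <= x ->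
  \sum_(g : {ffun I -> C}) x ^+ mismatch g g0 <= expR ((#|I| * #|C|)%:R * x).
Proof.
move=> x0; pose F i k : R := if k == g0 i then 1 else x.
have -> : \sum_(g : {ffun I -> C}) x ^+ mismatch g g0 = \prod_i \sum_k F i k.
  rewrite bigA_distr_bigA; apply: eq_bigr => g _ /=.
  rewrite /mismatch -prodr_const big_mkcond/=; apply: eq_bigr => i _.
  by rewrite inE /F; case: (_ == _).
have FE i : \sum_k F i k <= expR (#|C|%:R * x).
  apply: le_trans (expR_ge1Dx _); rewrite (bigD1 (g0 i))//= {1}/F eqxx lerD2l.
  rewrite mulr_natl -sumr_const [leRHS](bigD1 (g0 i))//=.
  apply: le_trans (_ : \sum_(k | k != g0 i) x <= _); last by rewrite lerDr.
  by apply: ler_sum => k /negPf kg; rewrite /F kg.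
apply: le_trans (_ : \prod_(i : I) expR (#|C|%:R * x) <= _).
  apply: ler_prod => i _; rewrite FE andbT; apply: sumr_ge0 => k _.
  by rewrite /F; case: ifP.
by rewrite prodr_const -expRM_natl natrM mulrA.
Qed.

(** The total weight factorises into one sum per labelling, and the true pair accounts for exactly
    1. With weight [N ^- 4] and at most [N ^+ 2] point-label pairs on each side, the total is at
    most [expR (2 / N ^+ 2)], hence at most [1 + 4 / N ^+ 2]. *)
Lemma label_pair_weight_sum (I J C D : finType) (g0 : {ffun I -> C})
    (h0 : {ffun J -> D}) (N : R) :
  2 <= N -> #|I|%:R <= N -> #|J|%:R <= N -> #|C|%:R <= N -> #|D|%:R <= N ->
  \sum_(z : {ffun I -> C} * {ffun J -> D} | z != (g0, h0))
     (N ^- 4) ^+ (mismatch z.1 g0 + mismatch z.2 h0) <= 4 / N ^+ 2.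
Proof.
move=> N2 IN JN CN DN; set x := N ^- 4.
have x0 : 0 <= x by rewrite invr_ge0 exprn_ge0//; lra.
have N0 : 0 < N by lra.
have m0 (A B : finType) (f : A -> B) : mismatch f f = 0%N.
  by apply: eq_card0 => a; rewrite !inE eqxx.
have := label_weight_sum g0 x0; have := label_weight_sum h0 x0.
set Sh := \sum_(g : _) _; set Sg := \sum_(g : _) _ => hh hg.
have tot : Sg * Sh = 1 + \sum_(z : {ffun I -> C} * {ffun J -> D} | z != (g0, h0))
    x ^+ (mismatch z.1 g0 + mismatch z.2 h0).
  rewrite -sum_kron (bigD1 (g0, h0))//= !m0 !expr0 mul1r; congr (_ + _).
  by apply: eq_bigr => z _; rewrite exprD.
have le2 : Sg * Sh <= expR (2 / N ^+ 2).
  apply: le_trans (_ : _ <= expR ((#|I| * #|C|)%:R * x) * expR ((#|J| * #|D|)%:R * x)) _.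
    by apply: ler_pM => //; apply: sumr_ge0 => ? _; exact: exprn_ge0.
  rewrite -expRD ler_expR -mulrDl -natrD.
  have -> : 2 / N ^+ 2 = (2 * N ^+ 2) * x by rewrite /x; field; rewrite gt_eqF.
  rewrite ler_wpM2r// natrD !natrM.
  have : #|I|%:R * #|C|%:R <= N * N by apply: ler_pM.
  have : #|J|%:R * #|D|%:R <= N * N by apply: ler_pM.
  by rewrite expr2; lra.
suff : expR (2 / N ^+ 2) <= 1 + 4 / N ^+ 2 by rewrite tot in le2; lra.
set u := 2 / N ^+ 2.
have u0 : 0 <= u by rewrite divr_ge0// exprn_ge0// ltW.
have u1 : u <= 1 / 2.
  rewrite ler_pdivrMr ?exprn_gt0//; have : 2 * 2 <= N * N by apply: ler_pM; lra.
  by rewrite expr2; lra.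
have -> : 4 / N ^+ 2 = 2 * u by rewrite /u; field; rewrite gt_eqF.
have := expR_ge1Dx (- u); rewrite expRN => h.
have e0 := expR_gt0 u.
have : 1 - u <= (expR u)^-1 by [].
rewrite -(ler_pM2r e0) mulVf ?gt_eqF// => h2.
nra.
Qed.

End union_bound.

Section gaussian_union.
Context {R : realType} {d : measure_display} {T : measurableType d}.
Context {P : probability T R} {I : finType} {Y : I -> {RV P >-> R}}.
Context {M : I -> R} {s : R}.
Hypotheses (indY : mutually_independent Y) (s0 : 0 < s).
Hypothesis lawY : forall i, has_normal_law (Y i) (M i) s.

Let X i w := (Y i w - M i) / s.

(* The threshold of [gaussian_quad_tail]: the probability is at most [exp (- tau)]. *)
Definition tail_event (A : I -> I -> R) (F tau : R) : set T :=
  [set w | \sum_i A i i + (3 * F * Num.sqrt tau + 16 * tau)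
           < quad A (fun i => (Y i w - M i) / s)].

Lemma measurable_tail_event A F tau : measurable (tail_event A F tau).
Proof.
have mq : measurable_fun setT (fun w => quad A (X ^~ w)).
  under eq_fun do rewrite -qformT; apply: measurable_qform => i _.
  by apply: measurable_funM => //; exact: measurable_funB.
rewrite (_ : tail_event _ _ _ = [set: T] `&` (fun w => quad A (X ^~ w)) @^-1`
    `](\sum_i A i i + (3 * F * Num.sqrt tau + 16 * tau)), +oo[); last first.
  by rewrite setTI; apply/seteqP; split => w; rewrite /tail_event/= in_itv/= andbT.
exact: mq.
Qed.

Definition tail_union (U : finType) (Q : pred U) (A : U -> I -> I -> R)
    (F tau : U -> R) : set T :=
  \bigcup_(z in [set` Q]) tail_event (A z) (F z) (tau z).

Lemma measurable_tail_union (U : finType) (Q : pred U) A F tau :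
  measurable (tail_union Q A F tau).
Proof.
by apply: fin_bigcup_measurable => // z _; exact: measurable_tail_event.
Qed.

Lemma tail_union_le (U : finType) (Q : pred U) (A : U -> I -> I -> R)
    (F tau : U -> R) :
  (forall z, Q z -> [/\ forall i j, A z i j = A z j i,
     forall y, quad (A z) y <= 2 * \sum_j y j ^+ 2,
     \sum_i \sum_j A z i j ^+ 2 <= F z ^+ 2, 0 <= F z & 0 <= tau z]) ->
  (P (tail_union Q A F tau) <= (\sum_(z | Q z) expR (- tau z))%:E)%E.
Proof.
move=> H.
have -> : tail_union Q A F tau = \big[setU/set0]_(z | Q z) tail_event (A z) (F z) (tau z).
  by rewrite -bigcup_pred.
rewrite -sumEFin.
(* Measurability travels with the bound because subadditivity requires it at each step. *)
pose rel (U : set T) (S : \bar R) := measurable U /\ (P U <= S)%E.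
suff : rel (\big[setU/set0]_(z | Q z) tail_event (A z) (F z) (tau z))
    (\sum_(z | Q z) (expR (- tau z))%:E)%E by case.
apply: big_rec2; first by split; rewrite ?measure0.
move=> z S V Qz [mV PV]; have [? ? ? ? ?] := H z Qz.
split; first by apply: measurableU => //; exact: measurable_tail_event.
apply: le_trans (measureU2 _ _ _) _ => //; first exact: measurable_tail_event.
by apply: leeD => //; exact: gaussian_quad_tail.
Qed.

End gaussian_union.

(** * Comparison of signal and noise *)

Section noise.
Context {R : realType}.

Lemma sqrtr_le_sqr (a c : R) : 0 <= c -> a <= c ^+ 2 -> Num.sqrt a <= c.
Proof.
by move=> c0 ac; rewrite -[leRHS]ger0_norm// -sqrtr_sqr ler_wsqrtr.
Qed.

(** Here [m] and [q] are the mismatches, [l] is the logarithm, [dG] and [dH] are the squared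
    Frobenius distances between the projections, and [qB], [q1], [q2], [q3] are the four random
    forms off their tail events. *)
Lemma noise_budget (K L n p gam l m q dG dH qB q1 q2 q3 : R) :
  0 < K -> 0 < L -> 0 < n -> 0 < p -> 1 <= gam -> 1 <= l ->
  0 <= m -> 0 <= q -> 1 <= m + q -> 0 <= dG -> 0 <= dH ->
  dG <= 12 * m * (gam * K / n) -> dG <= 2 * K ->
  dH <= 12 * q * (gam * L / p) -> dH <= 2 * L ->
  qB <= 1 + (3 * 1 * Num.sqrt (4 * (m + q) * l) + 16 * (4 * (m + q) * l)) ->
  q1 <= 3 * Num.sqrt (dG * L) * Num.sqrt (4 * m * l) + 16 * (4 * m * l) ->
  q2 <= 3 * Num.sqrt (K * dH) * Num.sqrt (4 * q * l) + 16 * (4 * q * l) ->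
  q3 <= 3 * Num.sqrt (dG * dH) * Num.sqrt (4 * (m + q) * l) +
        16 * (4 * (m + q) * l) ->
  2 * qB + q1 + q2 + q3 <=
  300 * Num.sqrt gam * (m * (Num.sqrt (K * L * l / n) + l) +
                        q * (Num.sqrt (K * L * l / p) + l)).
Proof.
move=> K0 L0 n0 p0 g1 l1 m0 q0 mq1 G0 H0 dG1 dG2 dH1 dH2 hB h1 h2 h3.
have l0 : 0 <= l by lra.
have [K1 L1 n1 p1 gam0] : [/\ 0 <= K, 0 <= L, 0 <= n, 0 <= p & 0 <= gam].
  by split; lra.
set s := Num.sqrt gam; set x := Num.sqrt (K * L * l / n).
set y := Num.sqrt (K * L * l / p).
have s2 : s ^+ 2 = gam by rewrite sqr_sqrtr//; lra.
have s1 : 1 <= s by rewrite -[leLHS]sqrtr1 ler_wsqrtr.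
have x0 : 0 <= x by rewrite sqrtr_ge0.
have y0 : 0 <= y by rewrite sqrtr_ge0.
have KLl : 0 <= K * L * l by rewrite !mulr_ge0.
have x2 : x ^+ 2 = K * L * l / n by rewrite sqr_sqrtr// divr_ge0.
have y2 : y ^+ 2 = K * L * l / p by rewrite sqr_sqrtr// divr_ge0.
have s0 : 0 <= s by lra.
have smx0 : 0 <= s * (m * x) by rewrite !mulr_ge0.
have sqy0 : 0 <= s * (q * y) by rewrite !mulr_ge0.
have e3 : Num.sqrt (4 * (m + q) * l) <= 4 * (m + q) * l.
  apply: sqrtr_le_sqr; first by rewrite !mulr_ge0//; lra.
  have : 1 <= 4 * (m + q) * l.
    have : 1 * 1 <= (m + q) * l by apply: ler_pM.
    lra.
  by rewrite expr2 => h; rewrite ler_peMl//; lra.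
have e1 : Num.sqrt (dG * L) * Num.sqrt (4 * m * l) <= 7 * (s * (m * x)).
  rewrite -sqrtrM ?mulr_ge0//.
  apply: sqrtr_le_sqr; first by rewrite mulr_ge0.
  apply: le_trans (_ : 12 * m * (gam * K / n) * L * (4 * m * l) <= _).
    by do 2 (apply: ler_wpM2r; first by rewrite ?mulr_ge0).
  have -> : 12 * m * (gam * K / n) * L * (4 * m * l) = 48 * (s * (m * x)) ^+ 2.
    by rewrite !exprMn s2 x2; ring.
  by rewrite [leRHS]exprMn; apply: ler_wpM2r; [exact: sqr_ge0|lra].
have e2 : Num.sqrt (K * dH) * Num.sqrt (4 * q * l) <= 7 * (s * (q * y)).
  rewrite -sqrtrM ?mulr_ge0//.
  apply: sqrtr_le_sqr; first by rewrite mulr_ge0.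
  apply: le_trans (_ : K * (12 * q * (gam * L / p)) * (4 * q * l) <= _).
    by apply: ler_wpM2r; [rewrite ?mulr_ge0|apply: ler_wpM2l].
  have -> : K * (12 * q * (gam * L / p)) * (4 * q * l) = 48 * (s * (q * y)) ^+ 2.
    by rewrite !exprMn s2 y2; ring.
  by rewrite [leRHS]exprMn; apply: ler_wpM2r; [exact: sqr_ge0|lra].
(* The weight [m + q] is split. In the [m] part [dG] is bounded through the mismatch and [dH] by
   [2 * L]; in the [q] part the roles are exchanged. The constant 96 stays below the square of
   10. *)
have e4 : Num.sqrt (dG * dH) * Num.sqrt (4 * (m + q) * l) <=
    10 * (s * (m * x) + s * (q * y)).
  rewrite -sqrtrM ?mulr_ge0//.
  apply: sqrtr_le_sqr; first by rewrite mulr_ge0 ?addr_ge0.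
  apply: le_trans (_ : 96 * (s * (m * x)) ^+ 2 + 96 * (s * (q * y)) ^+ 2 <= _);
    last by nra.
  have -> : dG * dH * (4 * (m + q) * l) =
    dG * dH * (4 * m * l) + dG * dH * (4 * q * l) by ring.
  apply: lerD.
    apply: le_trans (_ : 12 * m * (gam * K / n) * (2 * L) * (4 * m * l) <= _).
      by apply: ler_wpM2r; [rewrite ?mulr_ge0|apply: ler_pM].
    by rewrite !exprMn s2 x2 le_eqVlt; apply/orP; left; apply/eqP; ring.
  apply: le_trans (_ : 2 * K * (12 * q * (gam * L / p)) * (4 * q * l) <= _).
    by apply: ler_wpM2r; [rewrite ?mulr_ge0|apply: ler_pM].
  by rewrite !exprMn s2 y2 le_eqVlt; apply/orP; left; apply/eqP; ring.
have one : 1 * 1 <= (m + q) * l by apply: ler_pM.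
have sml : m * l <= s * (m * l) by rewrite ler_peMl// mulr_ge0.
have sql : q * l <= s * (q * l) by rewrite ler_peMl// mulr_ge0.
have ml0 : 0 <= m * l by rewrite mulr_ge0.
have ql0 : 0 <= q * l by rewrite mulr_ge0.
(* The coefficients add up to 51 for [s * (m * x)] and 282 for [m * l], and likewise for the
   columns; 300 covers both. *)
have -> : 300 * s * (m * (x + l) + q * (y + l)) = 300 * (s * (m * x)) +
  300 * (s * (m * l)) + 300 * (s * (q * y)) + 300 * (s * (q * l)) by ring.
lra.
Qed.

End noise.

(** * Surjective labellings, balanced class sizes and separation of the means *)

Definition onto (I C : finType) (g : I -> C) := [forall k, [exists i, g i == k]].

Lemma ontoP (I C : finType) (g : I -> C) :
  reflect (forall k, exists i, g i = k) (onto g).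
Proof.
apply: (iffP forallP) => H k.
  by have /existsP[i /eqP] := H k; exists i.
by have [i <-] := H k; apply/existsP; exists i.
Qed.

Lemma onto_card (I C : finType) (g : I -> C) : onto g -> (#|C| <= #|I|)%N.
Proof.
move=> /ontoP sg; rewrite -[#|I|]cardsT.
apply: leq_trans (leq_imset_card g _); apply: subset_leq_card.
by apply/fintype.subsetP => k _; have [i <-] := sg k; exact: imset_f.
Qed.

Lemma bigmin_seq_le (T : eqType) (r : seq T) (Q : pred T) (F : T -> nat) d x :
  x \in r -> Q x -> (\big[minn/d]_(y <- r | Q y) F y <= F x)%N.
Proof.
elim: r => // y r IHr; rewrite inE => /orP[/eqP <-|xr] Qx; rewrite big_cons.
  by rewrite Qx geq_minl.
by case: ifP => _; [rewrite geq_min IHr ?orbT|exact: IHr].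
Qed.

Section balance.
Context {R : realType}.

(** The witness is the size of the smallest class; summing the upper bounds over the classes gives
    [n <= gam * b * K]. *)
Lemma balanced_csize (n K : nat) (g : 'I_n -> 'I_K) (gam : R) :
  (0 < n)%N -> 0 < gam -> onto g -> balanced gam (unlabel (classes_of g)) ->
  exists b : R, [/\ 0 < b, forall k, b <= csize g k <= gam * b &
    b^-1 <= gam * K%:R / n%:R].
Proof.
move=> n0 gam0 /ontoP sg; rewrite /balanced; set G := unlabel _.
set mx := (\max_(A in G) _)%N; set mn := (\big[minn/_]_(A in G) _)%N => bal.
have clG k : classes_of g k \in G by apply: imset_f; rewrite inE.
have mn0 : (0 < mn)%N.
  rewrite /mn; elim/big_ind: _ => [|a b a0 b0|A /imsetP[k _ ->]].
  - by rewrite card_ord.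
  - by rewrite leq_min a0 b0.
  - by have [i gi] := sg k; apply/card_gt0P; exists i; rewrite inE gi.
have b0 : 0 < mn%:R :> R by rewrite ltr0n.
have bP k : (mn%:R : R) <= csize g k <= gam * mn%:R.
  rewrite -card_classes_of; apply/andP; split.
    by rewrite ler_nat; apply: bigmin_seq_le; rewrite ?mem_index_enum.
  move: bal; rewrite ler_pdivrMr//; apply: le_trans.
  by rewrite ler_nat /mx (bigD1 (classes_of g k))//= leq_maxl.
exists mn%:R; split; [exact: b0|exact: bP|].
rewrite -[leLHS]mul1r ler_pdivrMr// mulrAC ler_pdivlMr ?ltr0n// mul1r.
have -> : n%:R = \sum_k csize g k * 1 :> R.
  by rewrite -(sum_by_label g (fun=> 1)) sumr_const card_ord.
rewrite mulrAC mulr_natr -[in leRHS](card_ord K) -sumr_const.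
by apply: ler_sum => k _; rewrite mulr1; have /andP[] := bP k.
Qed.

Lemma sum_sqr_label_ge (J D : finType) (h : J -> D) (a : D -> R) (b : R) :
  (forall l, b <= csize h l) ->
  b * \sum_l a l ^+ 2 <= \sum_j a (h j) ^+ 2.
Proof.
move=> bh; rewrite (sum_by_label h (fun l => a l ^+ 2)) mulr_sumr.
by apply: ler_sum => l _; rewrite ler_wpM2r ?sqr_ge0.
Qed.

Lemma Delta_r2_le (p K L : nat) (mu : 'M[R]_(K, L)) (sigma : R) k k' :
  k != k' -> Delta_r2 p mu sigma <=
    p%:R / L%:R * ((\sum_l (mu k l - mu k' l) ^+ 2) / (2 * sigma ^+ 2)).
Proof.
move=> kk'; rewrite /Delta_r2 ler_wpM2l ?divr_ge0//.
apply: ge_inf.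
  exists 0 => _ /= [u _ <-]; apply: divr_ge0; last by rewrite pmulr_rge0 ?sqr_ge0.
  by apply: sumr_ge0 => i _; exact: sumr_sqr_ge0.
exists (k, k') => //=; congr (_ / _); rewrite /sqnorm2 big_ord1.
by apply: eq_bigr => l _; rewrite !mxE.
Qed.

Lemma Delta_c2_le (n K L : nat) (mu : 'M[R]_(K, L)) (sigma : R) l l' :
  l != l' -> Delta_c2 n mu sigma <=
    n%:R / K%:R * ((\sum_k (mu k l - mu k l') ^+ 2) / (2 * sigma ^+ 2)).
Proof.
move=> ll'; rewrite /Delta_c2 ler_wpM2l ?divr_ge0//.
apply: ge_inf.
  exists 0 => _ /= [u _ <-]; apply: divr_ge0; last by rewrite pmulr_rge0 ?sqr_ge0.
  by apply: sumr_ge0 => i _; exact: sumr_sqr_ge0.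
exists (l, l') => //=; congr (_ / _); rewrite /sqnorm2.
by apply: eq_bigr => k _; rewrite big_ord1 !mxE.
Qed.

(** Each label is repeated at least [b] times, and [b] is at least [p / (gam * L)]; this costs one
    factor [gam]. The roles of rows and columns are left open so that both separations are
    instances. *)
Lemma class_separation (J : finType) (p L : nat) (h : J -> 'I_L)
    (a : 'I_L -> R) (b gam sigma D : R) :
  (0 < p)%N -> (0 < L)%N -> 0 < gam -> 0 < sigma -> 0 < b ->
  (forall l, b <= csize h l) -> b^-1 <= gam * L%:R / p%:R ->
  D <= p%:R / L%:R * ((\sum_l a l ^+ 2) / (2 * sigma ^+ 2)) ->
  2 * sigma ^+ 2 * D / gam <= \sum_j a (h j) ^+ 2.
Proof.
move=> p0 L0 gam0 s0 b0 bh bp HD.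
apply: le_trans (sum_sqr_label_ge a bh); set A := \sum_l a l ^+ 2 in HD *.
have A0 : 0 <= A by exact: sumr_sqr_ge0.
have pR : 0 < p%:R :> R by rewrite ltr0n.
have LR : 0 < L%:R :> R by rewrite ltr0n.
have s2 : 0 < 2 * sigma ^+ 2 by rewrite mulr_gt0// exprn_gt0.
apply: le_trans (_ : 2 * sigma ^+ 2 / gam * (p%:R / L%:R * (A / (2 * sigma ^+ 2))) <= _).
  by rewrite mulrAC; apply: ler_wpM2l => //; rewrite divr_ge0 ?ltW.
have -> : 2 * sigma ^+ 2 / gam * (p%:R / L%:R * (A / (2 * sigma ^+ 2))) =
    p%:R / (gam * L%:R) * A.
  by field; rewrite !gt_eqF.
apply: ler_wpM2r => //.
rewrite -[b]invrK -[leLHS]invrK lef_pV2 ?posrE ?invr_gt0 ?divr_gt0 ?mulr_gt0//.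
by rewrite invf_div.
Qed.

End balance.

(** * Positivity of the gap of the criterion when no tail event occurs *)

Section gap.
Context {R : realType}.

Lemma mean_matrix_fixed (I J C D : finType) (g0 : I -> C) (h0 : J -> D)
    (mu : C -> D -> R) (u : I * J) :
  \sum_v kron (pmat g0) (pmat h0) u v * mu (g0 v.1) (h0 v.2) =
  mu (g0 u.1) (h0 u.2).
Proof.
rewrite sum_pair -(pmat_sum g0 (fun k => mu k (h0 u.2))); apply: eq_bigr => i _.
rewrite -(pmat_sum h0 (fun l => mu (g0 i) l)) mulr_sumr.
by apply: eq_bigr => j _; rewrite /kron/= mulrA.
Qed.

Lemma unlabel_perm (I : finType) (K : nat) (g : I -> 'I_K) (s : {perm 'I_K}) :
  unlabel (classes_of (s \o g)) = unlabel (classes_of g).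
Proof.
have E k : classes_of (s \o g) (s k) = classes_of g k.
  by apply/setP => i; rewrite !inE /= (inj_eq perm_inj).
apply/setP => A; apply/imsetP/imsetP => -[k _ ->].
  by exists (s^-1 k)%g => //; rewrite -E permKV.
by exists (s k) => //; rewrite E.
Qed.

(** Relabelling changes neither the projection nor the unlabelled partition, so a rival may be
    assumed aligned with the truth before its mismatch is counted. *)
Lemma aligned_labels (I J : finType) (K : nat) (g g0 : I -> 'I_K)
    (M : I * J -> R) (t b gam : R) : onto g -> 0 <= t ->
  (forall i i', g0 i != g0 i' -> t <= \sum_j (M (i, j) - M (i', j)) ^+ 2) ->
  0 <= b -> 0 <= gam -> (forall k, b <= csize g0 k <= gam * b) ->
  exists g1 : {ffun I -> 'I_K}, [/\ onto g1,
    unlabel (classes_of g1) = unlabel (classes_of g) &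
    forall B : J -> J -> R, is_proj B -> t / 2 * (mismatch g1 g0)%:R <=
      (1 + gam) * (\sum_u M u ^+ 2 - quad (kron (pmat g1) B) M)].
Proof.
move=> /ontoP sg t0 sep b0 gam0 bg.
have [s sP] := aligned_row_signal_ge g t0 sep b0 gam0 bg.
have E : finfun (s \o g) = s \o g :> (I -> 'I_K) by apply/funext => i; rewrite ffunE.
exists (finfun (s \o g)); rewrite E; split.
- apply/ontoP => k; have [i gi] := sg (s^-1 k)%g.
  by exists i; rewrite /= gi permKV.
- exact: unlabel_perm.
- move=> B pB; have := sP B pB.
  rewrite (_ : pmat (s \o g) = pmat g)//.
  by apply/funext => i; apply/funext => j; exact: pmat_perm.
Qed.

Definition frob (I : finType) (A : I -> I -> R) := \sum_i \sum_j A i j ^+ 2.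

Definition pdiff (I C : finType) (g g0 : I -> C) (i j : I) : R :=
  pmat g i j - pmat g0 i j.

Lemma frob_ge0 (I : finType) (A : I -> I -> R) : 0 <= frob A.
Proof. by apply: sumr_ge0 => i _; exact: sumr_sqr_ge0. Qed.

Lemma frob_kron (I J : finType) (A : I -> I -> R) (B : J -> J -> R) :
  frob (kron A B) = frob A * frob B.
Proof. exact: kron_frob. Qed.

Lemma frob_pmat (I C : finType) (g : I -> C) : onto g ->
  frob (pmat g) = #|C|%:R.
Proof.
by move=> /ontoP sg; rewrite /frob proj_frob ?pmat_trace//; exact: pmat_proj.
Qed.

Lemma trace_pdiff (I C : finType) (g g0 : I -> C) : onto g -> onto g0 ->
  \sum_i pdiff g g0 i i = 0.
Proof.
by move=> /ontoP sg /ontoP sg0; rewrite sumrB !pmat_trace// subrr.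
Qed.

Lemma pdiff_sym (I C : finType) (g g0 : I -> C) i j :
  pdiff g g0 i j = pdiff g g0 j i.
Proof. by rewrite /pdiff pmat_sym [pmat g0 i j]pmat_sym. Qed.

Lemma quad_pdiffl_le (I J C : finType) (g g0 : I -> C) (B : J -> J -> R) y :
  is_proj B -> quad (kron (pdiff g g0) B) y <= 2 * \sum_u y u ^+ 2.
Proof.
move=> pB; rewrite quad_kronBl.
have p1 := kron_proj (pmat_proj (R := R) g) pB.
have p2 := kron_proj (pmat_proj (R := R) g0) pB.
have := quad_proj_le y p1; have := quad_proj_ge0 y p2.
have := sumr_sqr_ge0 y; lra.
Qed.

(** The product expands into four projections, two of each sign; dropping the negative ones leaves
    the constant 2. *)
Lemma quad_pdiff2_le (I J C D : finType) (g g0 : I -> C) (h h0 : J -> D) y :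
  quad (kron (pdiff g g0) (pdiff h h0)) y <= 2 * \sum_u y u ^+ 2.
Proof.
rewrite quad_kronBl !quad_kronBr.
have pp (a : I -> C) (b : J -> D) :=
  kron_proj (pmat_proj (R := R) a) (pmat_proj (R := R) b).
have := quad_proj_le y (pp g h); have := quad_proj_le y (pp g0 h0).
have := quad_proj_ge0 y (pp g h0); have := quad_proj_ge0 y (pp g0 h); lra.
Qed.

(** The deterministic core: once the four forms are below their thresholds, the signal beats the
    noise for this rival. *)
Lemma crit_gap_gt0 (n p K L : nat) (g g0 : 'I_n -> 'I_K) (h h0 : 'I_p -> 'I_L)
    (M x : 'I_n * 'I_p -> R) (s gam l bG bH Dr Dc : R) :
  (0 < n)%N -> (0 < p)%N -> (0 < K)%N -> (0 < L)%N ->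
  0 < s -> 1 <= gam -> 1 <= l ->
  onto g -> onto g0 -> onto h -> onto h0 ->
  0 < bG -> (forall k, bG <= csize g0 k) -> bG^-1 <= gam * K%:R / n%:R ->
  0 < bH -> (forall k, bH <= csize h0 k) -> bH^-1 <= gam * L%:R / p%:R ->
  (forall u, \sum_v kron (pmat g0) (pmat h0) u v * M v = M u) ->
  let m := (mismatch g g0)%:R : R in let q := (mismatch h h0)%:R : R in
  let Q := kron (pmat g) (pmat h) in
  let S := \sum_u M u ^+ 2 - quad Q M in
  1 <= m + q ->
  2408 * (gam ^+ 2 * Num.sqrt gam) *
    (Num.sqrt (K%:R * L%:R * l / n%:R) + l) <= Dr ->
  2408 * (gam ^+ 2 * Num.sqrt gam) *
    (Num.sqrt (K%:R * L%:R * l / p%:R) + l) <= Dc ->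
  2 * s ^+ 2 * Dr / gam / 2 * m <= (1 + gam) * S ->
  2 * s ^+ 2 * Dc / gam / 2 * q <= (1 + gam) * S ->
  quad (rank1 (residual Q M)) x <=
    1 + (3 * 1 * Num.sqrt (4 * (m + q) * l) + 16 * (4 * (m + q) * l)) ->
  quad (kron (pdiff g g0) (pmat h0)) x <=
    3 * Num.sqrt (frob (pdiff g g0) * L%:R) * Num.sqrt (4 * m * l) +
    16 * (4 * m * l) ->
  quad (kron (pmat g0) (pdiff h h0)) x <=
    3 * Num.sqrt (K%:R * frob (pdiff h h0)) * Num.sqrt (4 * q * l) +
    16 * (4 * q * l) ->
  quad (kron (pdiff g g0) (pdiff h h0)) x <=
    3 * Num.sqrt (frob (pdiff g g0) * frob (pdiff h h0)) *
      Num.sqrt (4 * (m + q) * l) + 16 * (4 * (m + q) * l) ->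
  0 < quad (kron (pmat g0) (pmat h0)) (fun u => M u + s * x u) -
      quad Q (fun u => M u + s * x u).
Proof.
move=> n0 p0 K0 L0 s0 g1 l1 /ontoP sg /ontoP sg0 /ontoP sh /ontoP sh0 bG0 bG1 bG2
  bH0 bH1 bH2 HM; cbv zeta.
set m := (mismatch g g0)%:R; set q := (mismatch h h0)%:R.
set Q := kron (pmat g) (pmat h); set S := \sum_u M u ^+ 2 - quad Q M.
move=> mq hr hc sr sc tB t1 t2 t3.
have pQ : is_proj Q by apply: kron_proj; exact: pmat_proj.
have m0 : 0 <= m by []. have q0 : 0 <= q by [].
have S0 : 0 <= S by rewrite subr_ge0 quad_proj_le.
have := crit_gap_ge x s (pmat_proj (R := R) g) (pmat_proj g0) (pmat_proj h)
  (pmat_proj h0) HM; cbv zeta; rewrite -/Q -/S => gap.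
have nR : 0 < n%:R :> R by rewrite ltr0n.
have pR : 0 < p%:R :> R by rewrite ltr0n.
have KR : 0 < K%:R :> R by rewrite ltr0n.
have LR : 0 < L%:R :> R by rewrite ltr0n.
have dG1 : frob (pdiff g g0) <= 12 * m * (gam * K%:R / n%:R).
  apply: le_trans (pmat_dist_le sg sg0 bG0 bG1) _.
  by apply: ler_wpM2l bG2; rewrite mulr_ge0.
have dH1 : frob (pdiff h h0) <= 12 * q * (gam * L%:R / p%:R).
  apply: le_trans (pmat_dist_le sh sh0 bH0 bH1) _.
  by apply: ler_wpM2l bH2; rewrite mulr_ge0.
have dG2 : frob (pdiff g g0) <= 2 * K%:R.
  by have := pmat_dist_le_trace (R := R) sg sg0; rewrite card_ord.
have dH2 : frob (pdiff h h0) <= 2 * L%:R.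
  by have := pmat_dist_le_trace (R := R) sh sh0; rewrite card_ord.
have := noise_budget KR LR nR pR g1 l1 m0 q0 mq (frob_ge0 _) (frob_ge0 _)
  dG1 dG2 dH1 dH2 tB t1 t2 t3.
set x1 := Num.sqrt _ + l in hr *; set y1 := Num.sqrt _ + l in hc *.
set r := Num.sqrt gam in hr hc *; set nz := _ + _ + _ + _ => hn.
have x1l : l <= x1 by rewrite lerDr sqrtr_ge0.
have y1l : l <= y1 by rewrite lerDr sqrtr_ge0.
have r0 : 0 < r by rewrite sqrtr_gt0; lra.
have s2 : 0 < s ^+ 2 by rewrite exprn_gt0.
have gam0 : 0 < gam by lra.
(* The division by [gam] and the factor [1 + gam <= 2 * gam] use up [gam ^+ 2] of the separation;
   the remaining root [r] matches the one in the noise. *)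
have aux D z v : 2408 * (gam ^+ 2 * r) * z <= D -> 0 <= v ->
    2 * s ^+ 2 * D / gam / 2 * v <= (1 + gam) * S ->
    2408 * (s ^+ 2 * r * (v * z)) <= 2 * S.
  move=> hD v0 hS.
  have h1 : s ^+ 2 * v * D <= 2 * gam ^+ 2 * S.
    have : (2 * s ^+ 2 * D / gam / 2 * v) * gam <= ((1 + gam) * S) * gam.
      by rewrite ler_pM2r.
    have -> : (2 * s ^+ 2 * D / gam / 2 * v) * gam = s ^+ 2 * v * D.
      by field; rewrite gt_eqF.
    move/le_trans; apply; rewrite -subr_ge0.
    have -> : 2 * gam ^+ 2 * S - (1 + gam) * S * gam = gam * S * (gam - 1) by ring.
    by rewrite mulr_ge0 ?subr_ge0// mulr_ge0// ltW.
  have h2 : s ^+ 2 * v * (2408 * (gam ^+ 2 * r) * z) <= s ^+ 2 * v * D.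
    by apply: ler_wpM2l => //; rewrite mulr_ge0// ltW.
  rewrite -(ler_pM2l (exprn_gt0 2 gam0)).
  apply: le_trans (_ : _ <= 2 * gam ^+ 2 * S) _.
    by apply: le_trans (le_trans h2 h1); rewrite le_eqVlt; apply/orP; left; apply/eqP; ring.
  by rewrite le_eqVlt; apply/orP; left; apply/eqP; ring.
(* Adding the two bounds gives [S / 2 >= 301 * s ^+ 2 * r * (m * x1 + q * y1)], as 2408 is 8 times
   301; the noise has 300 in place of 301. *)
have sm := aux _ _ _ hr m0 sr; have sq := aux _ _ _ hc q0 sc.
have W0 : 0 < m * x1 + q * y1.
  have : 1 <= (m + q) * l by rewrite -[leLHS]mulr1; apply: ler_pM.
  have : m * l <= m * x1 by rewrite ler_wpM2l.
  have : q * l <= q * y1 by rewrite ler_wpM2l.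
  lra.
apply: lt_le_trans gap.
have hn2 : s ^+ 2 * nz <= s ^+ 2 * (300 * r * (m * x1 + q * y1)).
  by rewrite ler_pM2l.
have : 0 < s ^+ 2 * r * (m * x1 + q * y1) by rewrite !mulr_gt0.
have E : s ^+ 2 * (300 * r * (m * x1 + q * y1)) =
   300 * (s ^+ 2 * r * (m * x1)) + 300 * (s ^+ 2 * r * (q * y1)) by ring.
move=> hW; change (0 < S / 2 - s ^+ 2 * nz).
rewrite mulrDr in hW; rewrite E in hn2; clearbody nz; lra.
Qed.

End gap.

(** * Exact recovery *)

Section recovery.
Context {R : realType}.

Lemma expR_weight (N : R) (k : nat) : 0 < N ->
  expR (- (4 * k%:R * ln N)) = (N ^- 4) ^+ k.
Proof.
move=> N0; rewrite expRN exprVn; congr (_^-1).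
by rewrite -exprM -[in RHS](lnK N0) -expRM_natl natrM.
Qed.

(** There are finitely many candidate pairs: the event says that each valid pair other than the
    hidden one fails to be a minimiser, which is a finite combination of comparisons of measurable
    functions. *)
Lemma measurable_exact_recovery d (T : measurableType d) (P : probability T R)
    (n p K L : nat) (Y : 'I_n * 'I_p -> {RV P >-> R})
    (Gs : 'I_K -> {set 'I_n}) (Hs : 'I_L -> {set 'I_p}) :
  measurable (exact_recovery Y Gs Hs).
Proof.
have mY i j : measurable_fun setT (fun w => observed Y w i j).
  rewrite (_ : (fun w => _) = Y (i, j)); first exact: measurable_funPT.
  by apply/funext => w; rewrite mxE.
have mcrit G H : measurable_fun setT (fun w => biKmeans_crit (observed Y w) G H).
  apply: measurable_sum_in => A _; apply: measurable_sum_in => B _.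
  apply: measurable_sum_in => i _; apply: measurable_sum_in => j _.
  apply: measurable_funX; apply: measurable_funB.
    exact: mY.
  apply: measurable_funM => //.
  apply: measurable_sum_in => i' _; apply: measurable_sum_in => j' _.
  exact: mY.
pose C := ({set {set 'I_n}} * {set {set 'I_p}})%type.
pose better (z z' : C) : set T := [set w | biKmeans_crit (observed Y w) z.1 z.2 <=
  biKmeans_crit (observed Y w) z'.1 z'.2].
have mbetter z z' : measurable (better z z').
  rewrite (_ : better _ _ = [set: T] `&` (fun w =>
      biKmeans_crit (observed Y w) z.1 z.2 -
      biKmeans_crit (observed Y w) z'.1 z'.2) @^-1` `]-oo, 0]); last first.
    by rewrite setTI; apply/seteqP; split => w; rewrite /better/= in_itv/= subr_le0.
  exact: measurable_funB.
pose valid (z : C) := partition_into K z.1 && partition_into L z.2.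
pose truth (z : C) := (z.1 == unlabel Gs) && (z.2 == unlabel Hs).
rewrite (_ : exact_recovery Y Gs Hs = \bigcap_(z in [set` [pred z | valid z && ~~ truth z]])
    ~` \bigcap_(z' in [set` valid]) better z z'); last first.
  apply/seteqP; split => w /=.
    move=> H z /= /andP[/andP[v1 v2] /negP nt] hz; apply: nt.
    have [] := H z.1 z.2; last by move=> e1 e2; rewrite /truth -e1 -e2 !eqxx.
    by split => // G' H' pG' pH'; apply: (hz (G', H')); apply/andP.
  move=> hw G H [pG pH Hmin]; apply: contrapT => nt.
  apply: (hw (G, H)) => /=.
    by rewrite inE /valid/= pG pH; apply/negP => /andP[/eqP e1 /eqP e2]; apply: nt.
  by move=> [G' H'] /andP[pG' pH']; exact: Hmin.
apply: fin_bigcap_measurable => // z _; apply: measurableC.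
exact: fin_bigcap_measurable.
Qed.

Section bad_event.
Context {d : measure_display} {T : measurableType d} {P : probability T R}.
Context {n p K L : nat} {Y : 'I_n * 'I_p -> {RV P >-> R}}.
Context {M : 'I_n * 'I_p -> R} {s : R}.
Variables (g0 : {ffun 'I_n -> 'I_K}) (h0 : {ffun 'I_p -> 'I_L}).
Hypotheses (indY : mutually_independent Y) (s0 : 0 < s).
Hypothesis lawY : forall u, has_normal_law (Y u) (M u) s.
Hypotheses (sg0 : onto g0) (sh0 : onto h0).
Let N : R := (maxn n p)%:R.
Hypothesis N2 : 2 <= N.

Local Notation labels := ({ffun 'I_n -> 'I_K} * {ffun 'I_p -> 'I_L})%type.
Let m (z : labels) : R := (mismatch z.1 g0)%:R.
Let q (z : labels) : R := (mismatch z.2 h0)%:R.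

Definition rivals : pred labels :=
  fun z => [&& onto z.1, onto z.2 & z != (g0, h0)].

(** The first two forms involve one labelling only. Fixing the other at its true value indexes them
    by pairs without repetition, so that one sum of weights over pairs serves all four unions. *)
Definition bad_event : set T :=
  tail_union (Y := Y) (M := M) (s := s)
    [pred z | rivals z && (z.2 == h0)]
    (fun z => kron (pdiff z.1 g0) (pmat h0))
    (fun z => Num.sqrt (frob (pdiff z.1 g0) * L%:R))
    (fun z => 4 * m z * ln N) `|`
  tail_union (Y := Y) (M := M) (s := s)
    [pred z | rivals z && (z.1 == g0)]
    (fun z => kron (pmat g0) (pdiff z.2 h0))
    (fun z => Num.sqrt (K%:R * frob (pdiff z.2 h0)))
    (fun z => 4 * q z * ln N) `|`
  tail_union (Y := Y) (M := M) (s := s) rivals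
    (fun z => kron (pdiff z.1 g0) (pdiff z.2 h0))
    (fun z => Num.sqrt (frob (pdiff z.1 g0) * frob (pdiff z.2 h0)))
    (fun z => 4 * (m z + q z) * ln N) `|`
  tail_union (Y := Y) (M := M) (s := s) rivals
    (fun z => rank1 (residual (kron (pmat z.1) (pmat z.2)) M))
    (fun=> 1)
    (fun z => 4 * (m z + q z) * ln N).

Lemma measurable_bad_event : measurable bad_event.
Proof.
by do 3 (apply: measurableU; last exact: measurable_tail_union);
  exact: measurable_tail_union.
Qed.

(** Each of the four unions is bounded by the sum of the weights over all wrong pairs, at most
    [4 / N ^+ 2]. *)
Lemma bad_event_le : (P bad_event <= (16 / N ^+ 2)%:E)%E.
Proof.
have N0 : 0 < N by apply: lt_le_trans N2.
have l0 : 0 <= ln N by rewrite ln_ge0// (le_trans _ N2)// ler1n.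
have W : \sum_(z : labels | z != (g0, h0))
    (N ^- 4) ^+ (mismatch z.1 g0 + mismatch z.2 h0) <= 4 / N ^+ 2.
  apply: label_pair_weight_sum => //; rewrite ?card_ord ?ler_nat ?leq_maxl ?leq_maxr//.
  - by apply: leq_trans (leq_maxl _ _); have := onto_card sg0; rewrite !card_ord.
  - by apply: leq_trans (leq_maxr _ _); have := onto_card sh0; rewrite !card_ord.
have sub (Q : pred labels) (tau : labels -> R) :
    (forall z, Q z -> rivals z) ->
    (forall z, Q z -> tau z = 4 * (m z + q z) * ln N) ->
    \sum_(z | Q z) expR (- tau z) <= 4 / N ^+ 2.
  move=> Qr Qt; apply: le_trans W; rewrite big_mkcond [leRHS]big_mkcond/=.
  apply: ler_sum => z _; case: ifP => [Qz|_]; last first.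
    by case: ifP => // _; rewrite exprn_ge0// invr_ge0 exprn_ge0// ltW.
  have /and3P[_ _ ->] := Qr z Qz.
  by rewrite Qt// /m /q -natrD expR_weight.
have m0 (A B : finType) (f : A -> B) : mismatch f f = 0%N.
  by apply: eq_card0 => a; rewrite !inE eqxx.
have sqrtF (A B : R) : 0 <= A -> 0 <= B -> Num.sqrt (A * B) ^+ 2 = A * B.
  by move=> A0 B0; rewrite sqr_sqrtr// mulr_ge0.
have tau0 a : 0 <= a -> 0 <= 4 * a * ln N by move=> a0; rewrite !mulr_ge0.
have pH := pmat_proj (R := R) h0; have pG := pmat_proj (R := R) g0.
have FH : frob (pmat h0) = L%:R :> R by rewrite frob_pmat// card_ord.
have FG : frob (pmat g0) = K%:R :> R by rewrite frob_pmat// card_ord.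
have -> : 16 / N ^+ 2 = 4 / N ^+ 2 + 4 / N ^+ 2 + 4 / N ^+ 2 + 4 / N ^+ 2.
  by field; rewrite gt_eqF.
rewrite !EFinD.
have mt := @measurable_tail_union.
have PU (A B : set T) (a b : \bar R) : measurable A -> measurable B ->
    (P A <= a)%E -> (P B <= b)%E -> (P (A `|` B) <= a + b)%E.
  by move=> mA mB Aa Bb; apply: le_trans (measureU2 _ mA mB) _; exact: leeD.
rewrite /bad_event.
apply: (PU); [by do 2 (apply: measurableU; last exact: mt); exact: mt|exact: mt| |].
apply: (PU); [by apply: measurableU; exact: mt|exact: mt| |].
apply: (PU); [exact: mt|exact: mt| |].
- apply: le_trans (tail_union_le indY s0 lawY _) _.
    move=> z _; split.
    + by move=> u v; rewrite /kron pdiff_sym pmat_sym.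
    + by move=> y; exact: quad_pdiffl_le.
    + by rewrite -/(frob _) frob_kron FH sqrtF ?frob_ge0.
    + exact: sqrtr_ge0.
    + exact: tau0.
  rewrite lee_fin; apply: sub => z /andP[]//= _ /eqP e.
  by rewrite /q e m0 addr0.
- apply: le_trans (tail_union_le indY s0 lawY _) _.
    move=> z _; split.
    + by move=> u v; rewrite /kron pdiff_sym pmat_sym.
    + move=> y; rewrite quad_kronC; apply: le_trans (quad_pdiffl_le _ _ _ pG) _.
      by rewrite !sum_pair exchange_big.
    + by rewrite -/(frob _) frob_kron FG sqrtF ?frob_ge0.
    + exact: sqrtr_ge0.
    + exact: tau0.
  rewrite lee_fin; apply: sub => z /andP[]//= _ /eqP e.
  by rewrite /m e m0 add0r.
- apply: le_trans (tail_union_le indY s0 lawY _) _.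
    move=> z _; split.
    + by move=> u v; rewrite /kron pdiff_sym [pdiff z.2 _ _ _]pdiff_sym.
    + by move=> y; exact: quad_pdiff2_le.
    + by rewrite -/(frob _) frob_kron sqrtF ?frob_ge0.
    + exact: sqrtr_ge0.
    + by apply: tau0; rewrite addr_ge0.
  by rewrite lee_fin; apply: sub.
- apply: le_trans (tail_union_le indY s0 lawY _) _.
    move=> z _; split => //.
    + by move=> u v; exact: rank1_sym.
    + move=> y; apply: le_trans (quad_rank1_le _ _) _.
      by have := sumr_sqr_ge0 y; lra.
    + by rewrite expr1n; exact: rank1_frob.
    + by apply: tau0; rewrite addr_ge0.
  by rewrite lee_fin; apply: sub.
Qed.

End bad_event.
End recovery.

Lemma tail_union_notin (R : realType) d (T : measurableType d)
    (P : probability T R) (I U : finType) (Y : I -> {RV P >-> R}) (M : I -> R)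
    (s : R) (Q : pred U) A F tau w z :
  ~ tail_union (Y := Y) (M := M) (s := s) Q A F tau w -> Q z ->
  quad (A z) (fun i => (Y i w - M i) / s) <=
    \sum_i A z i i + (3 * F z * Num.sqrt (tau z) + 16 * tau z).
Proof. by move=> nb Qz; rewrite leNgt; apply/negP => h; apply: nb; exists z. Qed.

Lemma mismatch_gt0 (I C : finType) (g g0 : {ffun I -> C}) :
  g != g0 -> (0 < mismatch g g0)%N.
Proof.
apply: contraNT; rewrite -eqn0Ngt cards_eq0 => /eqP e; apply/eqP/ffunP => i.
have : (i \in [set i | g i != g0 i]%SET) = false by rewrite e inE.
by rewrite inE => /negbFE/eqP.
Qed.

(* A variable [c] instead of the literal 2408 prevents the unary numeral from
   being unfolded by unification. *)
Lemma bad_event_recovery (R : realType) d (T : measurableType d)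
    (P : probability T R) (n p K L : nat) (c gam : R)
    (Y : 'I_n * 'I_p -> {RV P >-> R})
    (g0 : {ffun 'I_n -> 'I_K}) (h0 : {ffun 'I_p -> 'I_L})
    (mu : 'M[R]_(K, L)) (s : R) (w : T) :
  (2 <= K)%N -> (2 <= L)%N -> 0 < s -> (1 : R) <= ln (maxn n p)%:R -> 1 < gam ->
  onto g0 -> onto h0 ->
  partition_into K (unlabel (classes_of g0)) ->
  partition_into L (unlabel (classes_of h0)) ->
  balanced gam (unlabel (classes_of g0)) ->
  balanced gam (unlabel (classes_of h0)) ->
  c * (gam ^+ 2 * Num.sqrt gam) *
    (Num.sqrt (K%:R * L%:R * ln (maxn n p)%:R / n%:R) + ln (maxn n p)%:R)
    <= Delta_r2 p mu s ->
  c * (gam ^+ 2 * Num.sqrt gam) *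
    (Num.sqrt (K%:R * L%:R * ln (maxn n p)%:R / p%:R) + ln (maxn n p)%:R)
    <= Delta_c2 n mu s ->
  0 <= c -> c = 2408 ->
  ~ bad_event (Y := Y) (M := fun u => mu (g0 u.1) (h0 u.2)) (s := s) g0 h0 w ->
  exact_recovery Y (classes_of g0) (classes_of h0) w.
Proof.
set l := ln _; set M := fun u : 'I_n * 'I_p => mu (g0 u.1) (h0 u.2).
move=> K2 L2 s0 l1 gam1 sg0 sh0 pG0 pH0 balG balH hr hc c0 cE nbad G H [pG pH Hmin].
have K0 : (0 < K)%N by apply: leq_trans K2.
have L0 : (0 < L)%N by apply: leq_trans L2.
have n0 : (0 < n)%N.
  by have := onto_card sg0; rewrite !card_ord; apply: leq_trans.
have p0 : (0 < p)%N.
  by have := onto_card sh0; rewrite !card_ord; apply: leq_trans.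
have gam0 : 0 < gam by exact: lt_trans gam1.
have l0 : 0 <= l by exact: le_trans l1.
have r0 (x : R) : 0 <= c * (gam ^+ 2 * Num.sqrt gam) * (Num.sqrt x + l).
  rewrite mulr_ge0 ?addr_ge0 ?sqrtr_ge0// mulr_ge0//.
  by rewrite mulr_ge0 ?sqrtr_ge0 ?exprn_ge0// ltW.
have [bG [bG0 bGP bG2]] := balanced_csize n0 gam0 sg0 balG.
have [bH [bH0 bHP bH2]] := balanced_csize p0 gam0 sh0 balH.
have bG1 k : bG <= csize g0 k by have /andP[] := bGP k.
have bH1 k : bH <= csize h0 k by have /andP[] := bHP k.
have s2 : 0 <= 2 * s ^+ 2 by rewrite mulr_ge0// exprn_ge0// ltW.
have Dr0 : 0 <= Delta_r2 p mu s by exact: le_trans (r0 _) hr.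
have Dc0 : 0 <= Delta_c2 n mu s by exact: le_trans (r0 _) hc.
have tr0 : 0 <= 2 * s ^+ 2 * Delta_r2 p mu s / gam.
  by apply: divr_ge0 (ltW gam0); exact: mulr_ge0.
have tc0 : 0 <= 2 * s ^+ 2 * Delta_c2 n mu s / gam.
  by apply: divr_ge0 (ltW gam0); exact: mulr_ge0.
have sepr i i' : g0 i != g0 i' -> 2 * s ^+ 2 * Delta_r2 p mu s / gam <=
    \sum_j (M (i, j) - M (i', j)) ^+ 2.
  move=> ii'; apply: (class_separation
    (a := fun l => mu (g0 i) l - mu (g0 i') l) p0 L0 gam0 s0 bH0 bH1 bH2).
  exact: Delta_r2_le.
have sepc j j' : h0 j != h0 j' -> 2 * s ^+ 2 * Delta_c2 n mu s / gam <=
    \sum_i (M (i, j) - M (i, j')) ^+ 2.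
  move=> jj'; apply: (class_separation
    (a := fun k => mu k (h0 j) - mu k (h0 j')) n0 K0 gam0 s0 bG0 bG1 bG2).
  exact: Delta_c2_le.
have [B GE] := partition_labelled pG; rewrite GE in pG Hmin *.
have [g [/ontoP sg gE]] := label_of_partition pG.
have {gE} BE : B = classes_of g by apply/funext.
have [B' HE] := partition_labelled pH; rewrite HE in pH Hmin *.
have [h [/ontoP sh hE]] := label_of_partition pH.
have {hE} BE' : B' = classes_of h by apply/funext.
rewrite BE BE' in pG pH Hmin *; move=> {B B' GE HE BE BE'}.
have [g1 [sg1 g1E sr]] := aligned_labels (J := 'I_p) (g0 := g0) (M := M)
  sg tr0 sepr (ltW bG0) (ltW gam0) bGP.
(* The columns are handled by the row statement applied to the transposed mean matrix. *)
have [h1 [sh1 h1E sc]] := aligned_labels (J := 'I_n) (g0 := h0)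
  (M := fun u => M (u.2, u.1))
  sh tc0 sepc (ltW bH0) (ltW gam0) bHP.
rewrite -g1E -h1E in Hmin *.
have [e|ne] := eqVneq (g1, h1) (g0, h0); first by case: e => -> ->.
exfalso.
have rival : rivals g0 h0 (g1, h1) by rewrite /rivals /= sg1 sh1 ne.
have pP (I C : finType) (f : I -> C) := pmat_proj (R := R) f.
have triv (I C : finType) (f f' : {ffun I -> C}) i j : f = f' -> pdiff f f' i j = 0 :> R.
  by move=> ->; rewrite /pdiff subrr.
have /not_orP[/not_orP[/not_orP[nb1 nb2] nb3] nb4] := nbad.
pose x u := (Y u w - M u) / s.
pose m := mismatch g1 g0; pose q := mismatch h1 h0.
have mq : 1 <= m%:R + q%:R :> R.
  rewrite -natrD ler1n addn_gt0; move: ne; rewrite xpair_eqE negb_and.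
  by case/orP => /mismatch_gt0; rewrite /m /q => ->; rewrite ?orbT.
have gap : 0 < quad (kron (pmat g0) (pmat h0)) (fun u => M u + s * x u) -
    quad (kron (pmat g1) (pmat h1)) (fun u => M u + s * x u).
  apply: (crit_gap_gt0 n0 p0 K0 L0 s0 (ltW gam1) l1 sg1 sg0 sh1 sh0
    bG0 bG1 bG2 bH0 bH1 bH2 _ mq); [|by rewrite -cE; exact: hr|by rewrite -cE; exact: hc|..].
  - by move=> u; exact: (mean_matrix_fixed g0 h0 (fun k l => mu k l)).
  - by apply: sr; exact: pP.
  - have := sc _ (pP _ _ g1); rewrite quad_kronC.
    by rewrite !sum_pair exchange_big.
  - have := tail_union_notin nb4 rival; move/le_trans; apply.
    by rewrite lerD2r; exact: rank1_trace.
  (* If the rows are already correct, the form vanishes; otherwise [(g1, h0)] is a rival indexing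
     the first union. *)
  - have [e|ge] := eqVneq g1 g0.
      rewrite e /quad big1 => [|u _].
        by rewrite addr_ge0// !mulr_ge0 ?sqrtr_ge0.
      by rewrite big1// => v _; rewrite /kron triv// !mul0r.
    have rg : (g1, h0) \in [pred z | rivals g0 h0 z && (z.2 == h0)].
      by rewrite !inE /rivals/= sg1 sh0 eqxx xpair_eqE (negPf ge).
    have := tail_union_notin nb1 rg.
    by rewrite kron_trace trace_pdiff// mul0r add0r.
  - have [e|he] := eqVneq h1 h0.
      rewrite e /quad big1 => [|u _].
        by rewrite addr_ge0// !mulr_ge0 ?sqrtr_ge0.
      by rewrite big1// => v _; rewrite /kron triv// mulr0 !mul0r.
    have rh : (g0, h1) \in [pred z | rivals g0 h0 z && (z.1 == g0)].
      by rewrite !inE /rivals/= sg0 sh1 eqxx xpair_eqE (negPf he) andbF.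
    have := tail_union_notin nb2 rh.
    by rewrite kron_trace trace_pdiff// mulr0 add0r.
  - have := tail_union_notin nb3 rival.
    by rewrite kron_trace trace_pdiff// mul0r add0r.
(* The hidden pair is itself a candidate, so minimality against it contradicts the strict gap. *)
have := Hmin _ _ pG0 pH0.
rewrite !biKmeans_critE; try exact/ontoP.
have -> : (fun u => observed Y w u.1 u.2) = (fun u => M u + s * x u).
  apply/funext => -[i j]; rewrite mxE /x mulrC divfK ?gt_eqF//.
  by rewrite addrC subrK.
by rewrite lerD2l lerN2 leNgt -subr_gt0 gap.
Qed.

Theorem proposition5p2 (R : realType) :
  exists c c' c'' : R, [/\ 0 < c, 0 < c', 0 < c'' &
  forall (n p K L : nat) (gamma : R)
    (d : measure_display) (T : measurableType d) (P : probability T R)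
    (Y : 'I_n * 'I_p -> {RV P >-> R})
    (Gs : 'I_K -> {set 'I_n}) (Hs : 'I_L -> {set 'I_p})
    (mu : 'M[R]_(K, L)) (sigma : R),
    (2 <= K)%N -> (2 <= L)%N ->
    c' <= (maxn n p)%:R -> 1 < gamma ->
    biclustering_model Y Gs Hs mu sigma ->
    balanced gamma (unlabel Gs) -> balanced gamma (unlabel Hs) ->
    c * gamma `^ (5 / 2) *
      (Num.sqrt (K%:R * L%:R * ln (maxn n p)%:R / n%:R) + ln (maxn n p)%:R)
      <= Delta_r2 p mu sigma ->
    c * gamma `^ (5 / 2) *
      (Num.sqrt (K%:R * L%:R * ln (maxn n p)%:R / p%:R) + ln (maxn n p)%:R)
      <= Delta_c2 n mu sigma ->
    measurable (exact_recovery Y Gs Hs) /\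
    ((1 - c'' / (maxn n p)%:R ^+ 2)%:E < P (exact_recovery Y Gs Hs))%E].
Proof.
(* The constant 2408 makes half the signal exceed the noise. The threshold [expR 1] ensures both
   that the logarithm is at least 1 and that the dimension is at least 2. The value 17 exceeds the
   16 of [bad_event_le], which makes the final inequality strict. *)
exists 2408, (expR 1), 17.
split; [by rewrite ltr0n|exact: expR_gt0|by rewrite ltr0n|].
move=> n p K L gam d T P Y Gs Hs mu s K2 L2 eN gam1.
move=> [pG pH s0 indY lawY] balG balH hr hc.
split; first exact: measurable_exact_recovery.
have [g0 [/ontoP sg0 GE]] := label_of_partition pG.
have [h0 [/ontoP sh0 HE]] := label_of_partition pH.
have {}GE : Gs = classes_of g0 by apply/funext.
have {}HE : Hs = classes_of h0 by apply/funext.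
rewrite {Gs}GE {Hs}HE in pG pH lawY balG balH *.
have N0 : 0 < (maxn n p)%:R :> R by apply: lt_le_trans eN; exact: expR_gt0.
have N2 : 2 <= (maxn n p)%:R :> R.
  by apply: le_trans eN; exact: expR_ge1Dx.
have l1 : (1 : R) <= ln (maxn n p)%:R.
  by rewrite -ler_expR lnK.
have gE : gam `^ (5 / 2) = gam ^+ 2 * Num.sqrt gam.
  have g0' : 0 < gam by exact: lt_trans gam1.
  rewrite (_ : 5 / 2 = 2%:R + 1 / 2); last by field.
  rewrite powRD; last by rewrite gt_eqF// implybT.
  by rewrite powR_mulrn ?div1r ?powR12_sqrt// ltW.
rewrite gE in hr hc.
have law u : has_normal_law (Y u) (mu (g0 u.1) (h0 u.2)) s.
  by case: u => i j; apply: lawY; rewrite inE.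
pose bad := bad_event (Y := Y) (M := fun u => mu (g0 u.1) (h0 u.2)) (s := s) g0 h0.
have mbad : measurable bad by exact: measurable_bad_event.
have badP : (P bad <= (16 / (maxn n p)%:R ^+ 2)%:E)%E.
  exact: bad_event_le indY s0 law sg0 sh0 N2.
apply: (@lt_le_trans _ _ (P (~` bad))).
  rewrite probability_setC//; apply: lt_le_trans (leeB (lexx _) badP).
  by rewrite -EFinB lte_fin ltrD2l ltrN2 ltr_pM2r ?invr_gt0 ?exprn_gt0// ltr_nat.
apply: le_measure.
- by apply/mem_set; exact: measurableC.
- by apply/mem_set; exact: measurable_exact_recovery.
- move=> w nb; exact: (bad_event_recovery K2 L2 s0 l1 gam1 sg0 sh0 pG pH balG balH hr hc
    (ler0n _ _) erefl nb).
Qed.
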